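(* Let $n\ge 1$ and let $(X_t)_{t\ge 0}$ be a finite spin system on $\{0,1\}^n$ with rate functions $\lambda_i,\mu_i$, $i=1,\dots,n$. Suppose that $\lambda_i$ and $\mu_i$ are extended from $\{0,1\}^n$ to functions $[0,1]^n\to\mathbb{R}_+$ such that, on $[0,1]^n$, for every $i$: $\lambda_i$ is increasing and concave, $\mu_i$ is decreasing and convex, $\lambda_i+\mu_i$ is increasing and concave, and $\lambda_i$ and $\mu_i$ are Lipschitz continuous. Let $(W_t)_{t\ge0}$ be the corresponding independent site approximation, with $W_0=X_0$. Then the process $X$ is smaller in the lower orthant order than the process $W$; that is, for every subset $A\subseteq\{1,\dots,n\}$, all positive integers $m_i$ ($i\in A$) and all times $t_{i,1},\dots,t_{i,m_i}\in[0,\infty)$ ($i\in A$; the times may differ for different $i$), $$\mathbb{P}_0\left(X_{i,t_{i,j}}=0\text{ for all }i\in A,\ j\in\{1,\dots,m_i\}\right)\ \ge\ \mathbb{P}_0\left(W_{i,t_{i,j}}=0\text{ for all }i\in A,\ j\in\{1,\dots,m_i\}\right).$$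
   Context: Finite spin system: given functions $\lambda_i,\mu_i:\{0,1\}^n\to\mathbb{R}_+=[0,\infty)$, $i=1,\dots,n$, the spin system $X_t=(X_{1,t},\dots,X_{n,t})$ is the continuous time Markov jump process on $\{0,1\}^n$ in which, when the current state is $x$, coordinate $i$ flips from $0$ to $1$ at rate $\lambda_i(x)$ (if $x_i=0$) and from $1$ to $0$ at rate $\mu_i(x)$ (if $x_i=1$), for each $i$; only one coordinate changes at each jump. Deterministic process: with $\lambda_i,\mu_i$ extended to $[0,1]^n$, $p_t=(p_{1,t},\dots,p_{n,t})\in[0,1]^n$ is the solution, with $p_{i,0}=X_{i,0}$ for all $i$, to the system of ordinary differential equations $$p_{i,t}'=(1-p_{i,t})\,\lambda_i(p_t)-p_{i,t}\,\mu_i(p_t),\qquad i=1,\dots,n.$$ Independent site approximation: $W_t=(W_{1,t},\dots,W_{n,t})$, where $W_{1,\cdot},\dots,W_{n,\cdot}$ are independent continuous time (time-inhomogeneous) Markov chains on $\{0,1\}$ with $W_{i,0}=X_{i,0}$, such that at time $t$ the chain $W_{i,\cdot}$ jumps from $0$ to $1$ at rate $\lambda_i(p_t)$ and from $1$ to $0$ at rate $\mu_i(p_t)$. $\mathbb{P}_0$ denotes probability conditioned on the initial state $X_0$ (equivalently, the initial state $X_0\in\{0,1\}^n$ is fixed and deterministic). A function $f$ on $[0,1]^n$ is increasing (decreasing) if $f(x)\le f(y)$ (respectively $f(x)\ge f(y)$) whenever $x_j\le y_j$ for all $j$; monotonicity is in the weak sense. *)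

(* Defs.v *)
From HB Require Import structures.
From mathcomp Require Import all_boot all_order all_algebra.
From mathcomp Require Import all_classical all_reals all_analysis.

Set Implicit Arguments.
Unset Strict Implicit.
Unset Printing Implicit Defensive.

Import Order.TTheory GRing.Theory Num.Theory.
Import numFieldNormedType.Exports.

Local Open Scope classical_set_scope.
Local Open Scope ring_scope.

Section Ode.
Context {R : realType}.

(* [f' = g] on [s, +oo[.  Since [f] is right-continuous at [s], the one-sided
   equation at [s] itself follows whenever [g] is right-continuous at [s]. *)
Definition has_derivative_from (s : R) (f g : R -> R) : Prop :=
  derivable_oy_Rcontinuous (f : R -> R^o) s /\
  forall t, s < t -> derive1 (f : R -> R^o) t = g t.

End Ode.

Section MarkovJumpProcess.
Context {R : realType} {S : finType}.

(* Only the off-diagonal values of [q t x y], the rate at time [t] of the jumps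
   from [x] to [y], are used. *)
Definition generator (q : R -> S -> S -> R) (t : R) (x y : S) : R :=
  if x == y then - \sum_(z | z != x) q t x z else q t x y.

(* [p s t x y] is the probability to be in [y] at time [t] when in [x] at time
   [s].  The rates [q] enter through Kolmogorov's forward equation in [t].
   For time-dependent rates, requiring only
   [p t (t + h) x y = q t x y * h + o(h)] as [h --> 0+] would not exclude
   jumps at deterministic times. *)
Definition transition_function (q : R -> S -> S -> R)
    (p : R -> R -> S -> S -> R) : Prop :=
  [/\ forall s t x, 0 <= s <= t ->
        (forall y, 0 <= p s t x y) /\ \sum_y p s t x y = 1,
      forall s x y, 0 <= s -> p s s x y = (x == y)%:R,
      forall s t u x y, 0 <= s <= t -> t <= u ->
        p s u x y = \sum_z p s t x z * p t u z y &
      forall s x y, 0 <= s ->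
        has_derivative_from s (fun t => p s t x y)
          (fun t => \sum_z p s t x z * generator q t z y)].

Definition jump_path (Y : R -> S) : Prop :=
  (forall t, 0 <= t -> \forall s \near t^'+, Y s = Y t) /\
  (forall t, 0 < t -> exists y, \forall s \near t^'-, Y s = y).

(* Values of [X] at negative times are irrelevant.  The Markov property is
   multiplied out, so that conditioning events may have probability 0; the
   list [l] of (time, state) pairs is the past before time [s]. *)
Definition markov_jump_process d (T : measurableType d) (P : probability T R)
    (q : R -> S -> S -> R) (x0 : S) (X : R -> T -> S) : Prop :=
  [/\ forall t x, 0 <= t -> measurable [set w | X t w = x],
      forall w, jump_path (fun t => X t w),
      P [set w | X 0 w = x0] = 1%E &
      exists2 p, transition_function q p &
        forall (l : seq (R * S)) s t x y, 0 <= s <= t ->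
          (forall a, a \in l -> 0 <= a.1 <= s) ->
          (P [set w | [/\ forall a, a \in l -> X a.1 w = a.2,
                          X s w = x & X t w = y]] =
           P [set w | (forall a, a \in l -> X a.1 w = a.2) /\ X s w = x] *
           (p s t x y)%:E)%E].

End MarkovJumpProcess.

Section Independence.
Context {R : realType} d {T : measurableType d} (P : probability T R).

Definition process_sigma_algebra (S : Type) (Y : R -> T -> S) :
    set (set T) :=
  <<s [set B | exists t y, 0 <= t /\ B = [set w | Y t w = y]] >>.

Definition independent_processes (I : finType) (S : Type)
    (Y : I -> R -> T -> S) : Prop :=
  forall (J : {set I}) (E : I -> set T),
    (forall i, i \in J -> process_sigma_algebra (Y i) (E i)) ->
    P [set w | forall i, i \in J -> E i w] = (\prod_(i in J) P (E i))%E.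

End Independence.

Section SpinSystem.
Context {R : realType} {n : nat}.

(* The value [true] stands for 1 and [false] for 0. *)
Definition config := {ffun 'I_n -> bool}.

Definition vec_of_config (x : config) : 'rV[R]_n := \row_i (x i)%:R.

Definition flip (i : 'I_n) (x : config) : config :=
  [ffun j => if j == i then ~~ x j else x j].

Definition spin_rate (lam mu : 'I_n -> config -> R) (x y : config) : R :=
  \sum_(i | y == flip i x) (if x i then mu i x else lam i x).

Definition spin_system d (T : measurableType d) (P : probability T R)
    (lam mu : 'I_n -> config -> R) (x0 : config) (X : R -> T -> config) :
    Prop :=
  markov_jump_process P (fun _ => spin_rate lam mu) x0 X.

Definition unit_cube : set 'rV[R]_n := [set x | forall j, 0 <= x 0 j <= 1].

Definition increasing_on (D : set 'rV[R]_n) (f : 'rV[R]_n -> R) : Prop :=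
  forall x y, D x -> D y -> (forall j, x 0 j <= y 0 j) -> f x <= f y.

Definition decreasing_on (D : set 'rV[R]_n) (f : 'rV[R]_n -> R) : Prop :=
  forall x y, D x -> D y -> (forall j, x 0 j <= y 0 j) -> f y <= f x.

Definition convex_on (D : set 'rV[R]_n) (f : 'rV[R]_n -> R) : Prop :=
  convex_function (D : set (convex_lmodType 'rV[R]_n)) f.

Definition concave_on (D : set 'rV[R]_n) (f : 'rV[R]_n -> R) : Prop :=
  convex_on D (fun x => - f x).

Definition deterministic_process (lam mu : 'I_n -> 'rV[R]_n -> R)
    (x0 : config) (p : R -> 'rV[R]_n) : Prop :=
  [/\ forall t, 0 <= t -> unit_cube (p t),
      p 0 = vec_of_config x0 &
      forall i, has_derivative_from 0 (fun t => p t 0 i)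
        (fun t => (1 - p t 0 i) * lam i (p t) - p t 0 i * mu i (p t))].

Definition site_rate (lam mu : 'I_n -> 'rV[R]_n -> R) (p : R -> 'rV[R]_n)
    (i : 'I_n) (t : R) (a b : bool) : R :=
  match a, b with
  | false, true => lam i (p t)
  | true, false => mu i (p t)
  | _, _ => 0
  end.

Definition independent_site_approximation d (T : measurableType d)
    (P : probability T R) (lam mu : 'I_n -> 'rV[R]_n -> R) (x0 : config)
    (p : R -> 'rV[R]_n) (W : 'I_n -> R -> T -> bool) : Prop :=
  independent_processes P W /\
  forall i, markov_jump_process P (site_rate lam mu p i) (x0 i) (W i).

End SpinSystem.

Arguments config n : clear implicits.
Arguments unit_cube {R} n.

(* Main.v *)
(* Let [X] start from [x0], let [p] be the deterministic process and
   [sigma_i = lambda_i + mu_i].  Since each [lambda_i] is increasing and each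
   [mu_i] decreasing, the spin system is attractive, and as its jumps flip one
   site, Harris' inequality holds: at each time, a decreasing event of the path
   is negatively correlated with every increasing function of the current
   state.  Writing the drift of site [i] as
   [(1 - X_i) sigma_i(X) - mu_i(X)], Jensen's inequality and this negative
   correlation show that the means [E X_{i,t}] are a subsolution of the
   (quasimonotone) differential equation of [p], hence [E X_{i,t} <= p_{i,t}].

   For the theorem, let [h_i(t, a)] be the probability that the chain [W_i],
   when in [a] at time [t], is in 0 at all its later observation times.  The
   expectation of [\prod_i h_i(t, X_{i,t})] on the event that [X] meets the
   observations before [t] is nondecreasing in [t]: its derivative is a sum over
   [i] of the nonnegative [h_i(t, 0) - h_i(t, 1)] times the expectation of
   [(1 - X_i) (sigma_i(p) - sigma_i(X)) - (mu_i(p) - mu_i(X))] weighted by a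
   decreasing function, and Jensen's inequality applies again because, under
   these weights, the mean of each [X_k] is at most [p_k].  At [t = 0] this
   expectation is the probability for [W], and after the last observation time
   it is the probability for [X].

   Derivatives are replaced by one-step estimates with an error of order [h^2],
   uniform in time, which need only the forward equations. *)

Require Import Defs.
From HB Require Import structures.
From mathcomp Require Import all_boot all_order all_algebra.
From mathcomp Require Import all_classical all_reals all_analysis.
From mathcomp Require Import ring lra.

Set Implicit Arguments.
Unset Strict Implicit.
Unset Printing Implicit Defensive.

Import Order.TTheory GRing.Theory Num.Theory.
Import numFieldNormedType.Exports.

Local Open Scope classical_set_scope.
Local Open Scope ring_scope.

(** * Increments with quadratic errors *)

(** Over [N] equal steps the errors [C * h ^+ 2] accumulate to at most [expR (L * (b - a)) * C * (b
    - a) ^+ 2 / N], which tends to 0. *)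
Lemma discrete_gronwall (R : realType) (phi : R -> R) (a b L C h0 : R) :
  a <= b -> 0 <= L -> 0 <= C -> 0 < h0 -> phi a <= 0 ->
  (forall r h, a <= r -> 0 <= h <= h0 -> r + h <= b ->
     phi (r + h) <= (1 + L * h) * phi r + C * h ^+ 2) ->
  phi b <= 0.
Proof.
move=> ab L0 C0 h0_gt0 phia step; rewrite leNgt; apply/negP => phib.
pose D := expR (L * (b - a)) * C * (b - a) ^+ 2.
have D0 : 0 <= D by rewrite mulr_ge0 ?sqr_ge0 ?mulr_ge0 ?expR_ge0.
have ba0 : 0 <= b - a by rewrite subr_ge0.
(* One bound makes the accumulated error [D / N] smaller than [phi b], the other makes the step at
   most [h0]. *)
pose N := (Num.bound (D / phi b) + Num.bound ((b - a) / h0)).+1.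
have N0 : 0 < N%:R :> R by rewrite ltr0n.
have ltDN : D < N%:R * phi b.
  rewrite -ltr_pdivrMr //; apply: (lt_le_trans (archi_boundP _)).
    by rewrite divr_ge0// ltW.
  by rewrite ler_nat ltnW// ltnS leq_addr.
pose h := (b - a) / N%:R.
have hN : h * N%:R = b - a by rewrite /h divfK// gt_eqF.
have hh : 0 <= h <= h0.
  rewrite divr_ge0//= ler_pdivrMr// -ler_pdivrMl// mulrC.
  apply/ltW; apply: (lt_le_trans (archi_boundP _)); first by rewrite divr_ge0// ltW.
  by rewrite ler_nat ltnW// ltnS leq_addl.
have [hp hh0] := andP hh.
have L1 : 1 <= 1 + L * h by rewrite lerDl mulr_ge0.
have key k : (k <= N)%N ->
    phi (a + k%:R * h) <= (1 + L * h) ^+ k * (k%:R * (C * h ^+ 2)).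
  elim: k => [_|k IHk kN]; first by rewrite !mul0r addr0 mulr0.
  have -> : a + k.+1%:R * h = (a + k%:R * h) + h by rewrite -natr1; ring.
  apply: le_trans (step _ _ _ hh _) _.
  - by rewrite lerDl mulr_ge0.
  - rewrite -addrA -lerBrDl -hN -{2}[h]mul1r -mulrDl [leRHS]mulrC natr1.
    by rewrite ler_wpM2r// ler_nat.
  have := IHk (ltnW kN); rewrite -(ler_pM2l (lt_le_trans ltr01 L1)) => le1.
  have Ch : 0 <= C * h ^+ 2 by rewrite mulr_ge0// sqr_ge0.
  have : C * h ^+ 2 <= (1 + L * h) ^+ k.+1 * (C * h ^+ 2).
    by rewrite ler_peMl// exprn_ege1.
  move/(lerD le1)/le_trans; apply.
  rewrite -natr1 [(1 + L * h) ^+ k.+1]exprS le_eqVlt; apply/orP; left; apply/eqP; ring.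
have := key N (leqnn N).
have -> : a + N%:R * h = b by rewrite mulrC hN addrC subrK.
apply/negP; rewrite -ltNge -(ltr_pM2l N0); apply: le_lt_trans ltDN.
have -> : N%:R * ((1 + L * h) ^+ N * (N%:R * (C * h ^+ 2))) =
          (1 + L * h) ^+ N * (C * (h * N%:R) ^+ 2) by ring.
rewrite hN /D -mulrA ler_wpM2r ?mulr_ge0 ?sqr_ge0//.
rewrite -hN mulrA expRM_natr lerXn2r ?nnegrE ?expR_ge0//.
  exact: le_trans ler01 L1.
exact: expR_ge1Dx.
Qed.

Lemma nondecreasing_of_quadratic_defect (R : realType) (phi : R -> R)
    (a b C : R) :
  a <= b -> 0 <= C ->
  (forall r h, a <= r -> 0 <= h <= 1 -> r + h <= b ->
     phi r - C * h ^+ 2 <= phi (r + h)) ->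
  phi a <= phi b.
Proof.
move=> ab C0 step; rewrite -subr_le0.
apply: (@discrete_gronwall _ (fun r => phi a - phi r) a b 0 C 1) => //.
  by rewrite subrr.
move=> r h ar hh rh; have := step r h ar hh rh; lra.
Qed.

(** Mean value theorem. With [c = 0] it gives Lipschitz bounds, and with [c] the slope at [a] and
    [K] of order [b - a] it gives Euler steps with quadratic error. *)
Lemma has_derivative_from_increment (R : realType) (s a b c K : R)
    (f g : R -> R) :
  has_derivative_from s f g -> s <= a -> a <= b ->
  (forall u, a < u < b -> `|g u - c| <= K) ->
  `|f b - f a - (b - a) * c| <= K * (b - a).
Proof.
move=> [df fg] sa; rewrite le_eqVlt => /predU1P[<- _|ab gK].
  by rewrite !subrr mul0r subr0 normr0 mulr0.
have fab := derivable_oy_continuousWoo ab sa df.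
have cf := derivable_oo_LRcontinuous_within fab.
have [u|u + ->] := MVT (df := g) ab _ cf.
  rewrite in_itv/= => /andP[au ub]; have su := le_lt_trans sa au.
  rewrite -fg// derive1E; apply: DeriveDef => //.
  by case: df => + _; apply; rewrite in_itv/= su.
rewrite in_itv/= => /gK gc.
rewrite [X in _ - X]mulrC -mulrBl normrM.
have ba : 0 <= b - a by rewrite subr_ge0 ltW.
by rewrite (ger0_norm ba) ler_wpM2r.
Qed.

Lemma finite_uniform_bound (R : realType) (I : finType) (Q : I -> R -> Prop) :
  (forall i x y, x <= y -> Q i x -> Q i y) -> (forall i, exists x, Q i x) ->
  exists2 x, 0 <= x & forall i, Q i x.
Proof.
move=> mono /choice[K QK]; exists (\sum_i `|K i|); first exact: sumr_ge0.
move=> i; apply: mono (QK i); apply: le_trans (ler_norm _) _.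
by rewrite (bigD1 i)//= lerDl sumr_ge0.
Qed.

(** * Markov operators on a finite state space *)

Section MarkovOperators.
Variables (R : realType) (S : finType).
Implicit Types (p : R -> R -> S -> S -> R) (q : R -> S -> S -> R).
Implicit Types (f g : S -> R) (s t h : R).

Definition markov_op p s t f x : R := \sum_y p s t x y * f y.

Definition jump_op (r : S -> S -> R) f x : R := \sum_y r x y * (f y - f x).

(** First-order expansion of the transition operators, uniform in the starting time; through it the
    forward equations enter all later estimates. *)
Definition short_time p q (C : R) : Prop :=
  forall s h f x, 0 <= s -> 0 <= h -> (forall y, `|f y| <= 1) ->
    `|markov_op p s (s + h) f x - (f x + h * jump_op (q s) f x)| <= C * h ^+ 2.

Lemma sum_generator q t f x :
  \sum_y generator q t x y * f y = jump_op (q t) f x.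
Proof.
rewrite /jump_op (bigD1 x)//= [RHS](bigD1 x)//= subrr mulr0 add0r.
rewrite {1}/generator eqxx mulNr mulr_suml addrC -sumrB.
by apply: eq_bigr => y yx; rewrite /generator eq_sym (negbTE yx) mulrBr.
Qed.

Section Flow.
Variables (p : R -> R -> S -> S -> R) (q : R -> S -> S -> R).
Hypothesis hp : transition_function q p.

Lemma transition_ge0 s t x y : 0 <= s <= t -> 0 <= p s t x y.
Proof. by case: hp => + _ _ _ => /[apply] /(_ x)[]. Qed.

Lemma transition_sum1 s t x : 0 <= s <= t -> \sum_y p s t x y = 1.
Proof. by case: hp => + _ _ _ => /[apply] /(_ x)[]. Qed.

Lemma markov_op_le s t f g x : 0 <= s <= t -> (forall y, f y <= g y) ->
  markov_op p s t f x <= markov_op p s t g x.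
Proof.
by move=> st fg; apply: ler_sum => y _; rewrite ler_wpM2l ?transition_ge0.
Qed.

Lemma markov_op_cst s t c x : 0 <= s <= t -> markov_op p s t (fun=> c) x = c.
Proof.
by move=> st; rewrite /markov_op -mulr_suml transition_sum1// mul1r.
Qed.

Lemma markov_op_id s f x : 0 <= s -> markov_op p s s f x = f x.
Proof.
move=> s0; have [_ pss _ _] := hp.
rewrite /markov_op (bigD1 x)//= big1 ?addr0 => [|y yx]; rewrite pss//.
  by rewrite eqxx mul1r.
by rewrite eq_sym (negbTE yx) mul0r.
Qed.

Lemma markov_op_comp s t u f x : 0 <= s <= t -> t <= u ->
  markov_op p s u f x = markov_op p s t (markov_op p t u f) x.
Proof.
move=> st tu; have [_ _ ck _] := hp; rewrite /markov_op.
under eq_bigr => y _ do rewrite (ck _ _ _ _ _ st tu) mulr_suml.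
rewrite exchange_big/=; apply: eq_bigr => z _; rewrite mulr_sumr.
by apply: eq_bigr => y _; rewrite mulrA.
Qed.

Lemma eq_markov_op s t f g x : f =1 g ->
  markov_op p s t f x = markov_op p s t g x.
Proof. by move=> fg; apply: eq_bigr => y _; rewrite fg. Qed.

Lemma markov_opB s t f g x :
  markov_op p s t (fun y => f y - g y) x =
  markov_op p s t f x - markov_op p s t g x.
Proof. by rewrite /markov_op -sumrB; apply: eq_bigr => y _; rewrite mulrBr. Qed.

Lemma markov_op_itv s t f x (a b : R) : 0 <= s <= t ->
  (forall y, a <= f y <= b) -> a <= markov_op p s t f x <= b.
Proof.
move=> st fab; rewrite -{1}(markov_op_cst a x st) -(markov_op_cst b x st).
by rewrite !markov_op_le// => y; case/andP: (fab y).
Qed.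

Lemma markov_op_dist s t f g x (e : R) : 0 <= s <= t ->
  (forall y, `|f y - g y| <= e) ->
  `|markov_op p s t f x - markov_op p s t g x| <= e.
Proof.
move=> st fg; rewrite -markov_opB ler_norml; apply: markov_op_itv => // y.
by rewrite -ler_norml.
Qed.

(** The forward equation is used twice: it first shows that the kernel is within [K * (u - s)] of
    the identity, and then that its derivative on [[s, s + h]] is within order [h] of the generator
    at [s]. *)
Lemma short_time_estimate (K : R) : 0 <= K ->
  (forall t x y, 0 <= t -> `|generator q t x y| <= K) ->
  (forall s t x y, 0 <= s <= t ->
     `|generator q t x y - generator q s x y| <= K * (t - s)) ->
  short_time p q (#|S|%:R * (#|S|%:R * K ^+ 2 + K)).
Proof.
move=> K0 Kbd Klip s h f x s0 h0 f1.
have [_ pss _ fwd] := hp.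
have ssh : s <= s + h by rewrite lerDl.
have near_id u z : s <= u -> `|p s u x z - (x == z)%:R| <= K * (u - s).
  move=> su.
  have := has_derivative_from_increment (c := 0) (K := K) (fwd s x z s0) (lexx s) su.
  rewrite pss// mulr0 subr0; apply => v /andP[sv _].
  have sv' : 0 <= s <= v by rewrite s0 ltW.
  rewrite subr0 (le_trans (ler_norm_sum _ _ _))//.
  rewrite -[leRHS]mul1r -(transition_sum1 x sv') mulr_suml ler_sum// => y _.
  rewrite normrM ger0_norm ?transition_ge0// ler_wpM2l ?transition_ge0//.
  by rewrite Kbd// (le_trans s0)// ltW.
have entry y : `|p s (s + h) x y - (x == y)%:R - h * generator q s x y|
    <= (#|S|%:R * K ^+ 2 + K) * h ^+ 2.
  rewrite -(pss s)//.
  have := has_derivative_from_increment (a := s) (b := s + h)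
    (c := generator q s x y) (K := (#|S|%:R * K ^+ 2 + K) * h) (fwd s x y s0).
  have -> : s + h - s = h by ring.
  move=> H; rewrite [h ^+ 2]expr2 mulrA; apply: H => // u /andP[su uh].
  have su' : 0 <= s <= u by rewrite s0 ltW.
  have uh' : u - s <= h by rewrite lerBlDl ltW.
  have us0 : 0 <= u - s by rewrite subr_ge0 ltW.
  have -> : \sum_z p s u x z * generator q u z y - generator q s x y =
      \sum_z (p s u x z - (x == z)%:R) * generator q u z y +
      (generator q u x y - generator q s x y).
    rewrite [X in _ = X + _](eq_bigr (fun z => p s u x z * generator q u z y -
      (x == z)%:R * generator q u z y)); last by move=> z _; rewrite mulrBl.
    have dE : \sum_z (x == z)%:R * generator q u z y = generator q u x y.
      rewrite (bigD1 x)//= eqxx mul1r big1 ?addr0// => z zx.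
      by rewrite eq_sym (negbTE zx) mul0r.
    by rewrite sumrB dE; ring.
  rewrite (le_trans (ler_normD _ _))// mulrDl lerD//.
    rewrite (le_trans (ler_norm_sum _ _ _))//.
    rewrite -mulrA [leRHS]mulr_natl -sumr_const ler_sum// => z _.
    rewrite normrM expr2 -mulrA [K * h]mulrC mulrA ler_pM//.
      by rewrite (le_trans (near_id _ _ (ltW su)))// ler_wpM2l.
    by rewrite Kbd// (le_trans s0)// ltW.
  by rewrite (le_trans (Klip _ _ _ _ su'))// ler_wpM2l.
rewrite -sum_generator /markov_op mulr_sumr.
rewrite -(markov_op_id f x s0) /markov_op -big_split -sumrB/=.
rewrite (le_trans (ler_norm_sum _ _ _))//.
rewrite -mulrA [leRHS]mulr_natl -sumr_const ler_sum// => y _.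
rewrite pss// mulrA -mulrDl -mulrBl normrM -[leRHS]mulr1 ler_pM//.
by rewrite opprD addrA; exact: entry.
Qed.

(** The transition operator is a limit of compositions of Euler steps. These stay in the class [K],
    so the inequality valid on [K] passes to the limit. *)
Lemma markov_op_euler_cone_le C h0 (K : (S -> R) -> Prop) s t f x y :
  short_time p q C -> 0 <= C -> 0 < h0 ->
  (forall g, K g -> forall z, `|g z| <= 1) ->
  (forall u h g, 0 <= u -> 0 <= h <= h0 -> K g ->
     K (fun z => g z + h * jump_op (q u) g z)) ->
  (forall g, K g -> g x <= g y) ->
  0 <= s <= t -> K f -> markov_op p s t f x <= markov_op p s t f y.
Proof.
move=> est C0 h0_gt0 K1 Kstep Kxy st Kf.
(* The earliest step is applied last, as operators act backwards in time; the errors only add up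
   because Markov operators are contractions. *)
have approx h k u : 0 <= u -> 0 <= h <= h0 -> exists2 g, K g &
    forall z, `|markov_op p u (u + k%:R * h) f z - g z| <= k%:R * (C * h ^+ 2).
  move=> + hh; elim: k u => [|k IHk] u u0.
    by exists f => // z; rewrite !mul0r addr0 markov_op_id// subrr normr0.
  have [hp0 _] := andP hh.
  have uh0 : 0 <= u + h by rewrite addr_ge0.
  have [g Kg gk] := IHk _ uh0.
  exists (fun z => g z + h * jump_op (q u) g z); first exact: Kstep.
  move=> z; have uuh : 0 <= u <= u + h by rewrite u0 lerDl.
  have -> : u + k.+1%:R * h = u + h + k%:R * h by rewrite -natr1; ring.
  have uhk : u + h <= u + h + k%:R * h by rewrite lerDl mulr_ge0.
  rewrite (markov_op_comp _ _ uuh uhk).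
  rewrite -(subrKA (markov_op p u (u + h) g z)) -natr1 mulrDl mul1r.
  rewrite (le_trans (ler_normD _ _))// lerD// ?markov_op_dist//.
  by apply: est => //; exact: K1.
have [s0 ts] := andP st.
rewrite -subr_le0.
(* The factor 2 accounts for the approximation at both [x] and [y]. *)
have bound N : ((t - s) / h0) <= N.+1%:R ->
    markov_op p s t f x - markov_op p s t f y <=
    (2 * C * (t - s) ^+ 2) / N.+1%:R.
  move=> hN; pose h := (t - s) / N.+1%:R.
  have hNE : N.+1%:R * h = t - s by rewrite /h mulrC divfK// pnatr_eq0.
  have hh : 0 <= h <= h0.
    rewrite divr_ge0 ?subr_ge0//= ler_pdivrMr ?ltr0n//.
    by rewrite mulrC -ler_pdivrMr.
  have [g Kg gN] := approx h N.+1 s s0 hh.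
  have -> : 2 * C * (t - s) ^+ 2 / N.+1%:R = 2 * (N.+1%:R * (C * h ^+ 2)).
    rewrite /h; field; by rewrite addrC natr1 pnatr_eq0.
  move: (gN x) (gN y) (Kxy g Kg); rewrite hNE [s + _]addrC subrK !ler_norml.
  by move: (N.+1%:R * _) => e /andP[? ?] /andP[? ?] ?; lra.
rewrite leNgt; apply/negP => d0.
set d := markov_op p s t f x - markov_op p s t f y in d0 bound.
pose D := 2 * C * (t - s) ^+ 2.
have D0 : 0 <= D by rewrite mulr_ge0 ?sqr_ge0 ?mulr_ge0.
pose N := (Num.bound (D / d) + Num.bound ((t - s) / h0))%N.
have /bound : (t - s) / h0 <= N.+1%:R.
  apply/ltW; apply: (lt_le_trans (archi_boundP _)).
    by rewrite divr_ge0 ?subr_ge0// ltW.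
  by rewrite ler_nat ltnW// ltnS leq_addl.
apply/negP; rewrite -/D -ltNge ltr_pdivrMr ?ltr0n// [d * _]mulrC -ltr_pdivrMr//.
apply: (lt_le_trans (archi_boundP _)); first by rewrite divr_ge0// ltW.
by rewrite ler_nat ltnW// ltnS leq_addr.
Qed.

End Flow.
End MarkovOperators.

(** * The semigroup of an attractive spin system *)

Section SpinSemigroup.
Variables (R : realType) (n : nat).
Implicit Types (x y z : config n) (f g v w : config n -> R).

Definition cfg_le x y := forall i, x i -> y i.

Definition cfg_incr f := forall x y, cfg_le x y -> f x <= f y.

Definition cfg_decr f := forall x y, cfg_le x y -> f y <= f x.

Lemma flip_same i x : flip i x i = ~~ x i.
Proof. by rewrite ffunE eqxx. Qed.

Lemma flip_other i j x : j != i -> flip i x j = x j.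
Proof. by rewrite ffunE => /negbTE->. Qed.

Lemma le_flip i x : ~~ x i -> cfg_le x (flip i x).
Proof.
move=> xi j xj; have [->|ji] := eqVneq j i; first by rewrite flip_same.
by rewrite flip_other.
Qed.

Lemma flip_le i x : x i -> cfg_le (flip i x) x.
Proof.
move=> xi j; have [->//|ji] := eqVneq j i.
by rewrite flip_other.
Qed.

Lemma flip_mono i x y : cfg_le x y -> x i = y i -> cfg_le (flip i x) (flip i y).
Proof.
move=> xy xyi j; have [->|ji] := eqVneq j i; first by rewrite !flip_same xyi.
by rewrite !flip_other//; exact: xy.
Qed.

Lemma flip_le_up i x y : cfg_le x y -> y i -> cfg_le (flip i x) y.
Proof.
move=> xy yi j; have [->//|ji] := eqVneq j i.
by rewrite flip_other//; exact: xy.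
Qed.

Lemma le_flip_down i x y : cfg_le x y -> ~~ x i -> cfg_le x (flip i y).
Proof.
move=> xy xi j; have [->|ji] := eqVneq j i; first by rewrite (negbTE xi).
by rewrite flip_other//; exact: xy.
Qed.

Section Rates.
Variables (lam mu : 'I_n -> config n -> R) (K : R).
Hypothesis lam_bd : forall i x, 0 <= lam i x <= K.
Hypothesis mu_bd : forall i x, 0 <= mu i x <= K.

Definition flip_rate i x : R := if x i then mu i x else lam i x.

Lemma flip_rate_bd i x : 0 <= flip_rate i x <= K.
Proof. by rewrite /flip_rate; case: ifP. Qed.

Lemma jump_op_spin f x : jump_op (spin_rate lam mu) f x =
  \sum_i flip_rate i x * (f (flip i x) - f x).
Proof.
rewrite /jump_op /spin_rate; under eq_bigr do rewrite mulr_suml.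
rewrite (exchange_big_dep predT)//=; apply: eq_bigr => i _.
by rewrite big_pred1_eq.
Qed.

Lemma jump_op_spin_bd f x : (forall y, 0 <= f y <= 1) ->
  `|jump_op (spin_rate lam mu) f x| <= n%:R * K.
Proof.
move=> f01; rewrite jump_op_spin (le_trans (ler_norm_sum _ _ _))//.
rewrite -[X in X%:R]card_ord [leRHS]mulr_natl -sumr_const ler_sum// => i _.
have /andP[r0 rK] := flip_rate_bd i x.
rewrite normrM (ger0_norm r0) -[leRHS]mulr1 ler_pM// ler_norml.
by move: (f01 x) (f01 (flip i x)) => /andP[? ?] /andP[? ?]; apply/andP; split; lra.
Qed.

Lemma euler_spin_itv f h x : 0 <= h -> h * (n%:R * K) <= 1 ->
  (forall y, 0 <= f y <= 1) ->
  0 <= f x + h * jump_op (spin_rate lam mu) f x <= 1.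
Proof.
move=> h0 hK f01; rewrite jump_op_spin.
have /andP[fx0 fx1] := f01 x.
have bd : - (n%:R * K * f x) <= \sum_i flip_rate i x * (f (flip i x) - f x)
    <= n%:R * K * (1 - f x).
  rewrite -mulrN -!(mulrA n%:R) -[X in X%:R]card_ord !mulr_natl -!sumr_const.
  apply/andP; split; apply: ler_sum => i _;
    have /andP[r0 rK] := flip_rate_bd i x;
    have /andP[g0 g1] := f01 (flip i x).
    apply: (@le_trans _ _ (flip_rate i x * - f x)).
      by rewrite !mulrN lerN2 ler_wpM2r.
    by rewrite ler_wpM2l// lerBDr addNr.
  apply: (@le_trans _ _ (flip_rate i x * (1 - f x))).
    by rewrite ler_wpM2l// lerD2r.
  by rewrite ler_wpM2r// subr_ge0.
move: bd => /andP[/(ler_wpM2l h0) bd0 /(ler_wpM2l h0) bd1].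
have : h * (n%:R * K) * f x <= f x by rewrite ler_piMl.
have : h * (n%:R * K) * (1 - f x) <= 1 - f x by rewrite ler_piMl// subr_ge0.
move=> H1 H2; apply/andP; split; lra.
Qed.

Hypothesis lam_incr : forall i, cfg_incr (lam i).
Hypothesis mu_decr : forall i, cfg_decr (mu i).

(** If [x i = y i], flipping both preserves the order and the rates are ordered favourably. If only
    [y i] holds, flipping either one alone preserves the order; this case, with two separate rates,
    produces the constant [2 * K]. *)
Lemma flip_rate_attractive f i x y : cfg_incr f -> cfg_le x y ->
  - (2 * K * (f y - f x)) <=
  flip_rate i y * (f (flip i y) - f y) - flip_rate i x * (f (flip i x) - f x).
Proof.
move=> fi xy; have fxy := fi _ _ xy; rewrite /flip_rate.
have d0 : 0 <= f y - f x by rewrite subr_ge0.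
have /andP[mx0 mxK] := mu_bd i x; have /andP[my0 myK] := mu_bd i y.
have /andP[lx0 lxK] := lam_bd i x; have /andP[ly0 lyK] := lam_bd i y.
have leK r : 0 <= r -> r <= K -> r * (f y - f x) <= K * (f y - f x).
  by move=> r0 rK; rewrite ler_wpM2r.
have K0 : 0 <= K * (f y - f x) by rewrite mulr_ge0// (le_trans mx0).
case xi : (x i); case yi : (y i).
- have H1 : 0 <= (mu i x - mu i y) * (f y - f (flip i y)).
    by rewrite mulr_ge0// subr_ge0; [exact: mu_decr|exact/fi/flip_le].
  have H2 : 0 <= mu i x * (f (flip i y) - f (flip i x)).
    by rewrite mulr_ge0// subr_ge0; apply/fi/flip_mono; rewrite ?xi ?yi.
  by have := leK _ mx0 mxK; lra.
- by have := xy i; rewrite xi yi => /(_ isT).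
- have H1 : 0 <= mu i y * (f (flip i y) - f x).
    by rewrite mulr_ge0// subr_ge0; apply/fi/le_flip_down; rewrite ?xi.
  have H2 : 0 <= lam i x * (f y - f (flip i x)).
    by rewrite mulr_ge0// subr_ge0; apply/fi/flip_le_up.
  by have := leK _ my0 myK; have := leK _ lx0 lxK; lra.
- have H1 : 0 <= (lam i y - lam i x) * (f (flip i y) - f y).
    by rewrite mulr_ge0// subr_ge0; [exact: lam_incr|apply/fi/le_flip; rewrite yi].
  have H2 : 0 <= lam i x * (f (flip i y) - f (flip i x)).
    by rewrite mulr_ge0// subr_ge0; apply/fi/flip_mono; rewrite ?xi ?yi.
  by have := leK _ lx0 lxK; lra.
Qed.

Lemma euler_spin_incr f h : 0 <= h -> h * (2 * (n%:R * K)) <= 1 -> cfg_incr f ->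
  cfg_incr (fun x => f x + h * jump_op (spin_rate lam mu) f x).
Proof.
move=> h0 hK fi x y xy; rewrite !jump_op_spin -subr_ge0.
have : - (2 * (n%:R * K) * (f y - f x)) <=
    \sum_i flip_rate i y * (f (flip i y) - f y) -
    \sum_i flip_rate i x * (f (flip i x) - f x).
  rewrite -sumrB mulrCA -mulrA -mulrN -[X in X%:R]card_ord mulr_natl -sumr_const.
  by apply: ler_sum => i _; exact: flip_rate_attractive.
move=> /(ler_wpM2l h0).
have : h * (2 * (n%:R * K)) * (f y - f x) <= f y - f x.
  by rewrite ler_piMl// subr_ge0; exact: fi.
by move=> ? ?; lra.
Qed.

Variable p : R -> R -> config n -> config n -> R.
Hypothesis hp : transition_function (fun=> spin_rate lam mu) p.
Variable C : R.
Hypothesis C0 : 0 <= C.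
Hypothesis est : short_time p (fun=> spin_rate lam mu) C.

Lemma spin_incr s t f : 0 <= s <= t -> (forall x, 0 <= f x <= 1) ->
  cfg_incr f -> cfg_incr (markov_op p s t f).
Proof.
move=> st f01 fi x y xy.
have K0 : 0 <= n%:R * K.
  rewrite -[X in X%:R]card_ord mulr_natl -sumr_const sumr_ge0// => i _.
  by have /andP[/le_trans] := lam_bd i x; apply.
(* Small enough for Euler steps to preserve both monotonicity and the bounds 0 and 1; the summand 1
   keeps the denominator positive. *)
pose h0 := (1 + 2 * (n%:R * K))^-1.
have h0V : 0 < 1 + 2 * (n%:R * K) by rewrite ltr_wpDr// mulr_ge0.
pose cone g := cfg_incr g /\ forall z, 0 <= g z <= 1.
apply: (markov_op_euler_cone_le hp (h0 := h0) (K := cone) est) => //.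
- by rewrite invr_gt0.
- by move=> g [_ g01] z; have /andP[g0 g1] := g01 z; rewrite ger0_norm.
- move=> u h g u0 /andP[h_ge0 hh0] [gi g01].
  have hK : h * (2 * (n%:R * K)) <= 1.
    have : h * (1 + 2 * (n%:R * K)) <= 1 by rewrite -ler_pdivlMr ?div1r.
    by rewrite mulrDr; lra.
  split; first exact: euler_spin_incr.
  move=> z; apply: euler_spin_itv => //.
  by have : 0 <= h * (n%:R * K) by [rewrite mulr_ge0]; lra.
- by move=> g [gi _]; exact: gi.
Qed.

Lemma spin_decr s t f : 0 <= s <= t -> (forall x, 0 <= f x <= 1) ->
  cfg_decr f -> cfg_decr (markov_op p s t f).
Proof.
move=> st f01 fd x y xy.
have g01 z : 0 <= 1 - f z <= 1.
  by have /andP[? ?] := f01 z; apply/andP; split; lra.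
have gi : cfg_incr (fun z => 1 - f z) by move=> a b ab; rewrite lerD2l lerN2 fd.
have := spin_incr st g01 gi xy.
by rewrite !markov_opB !(markov_op_cst hp)// lerD2l lerN2.
Qed.

(* The carre du champ of single-site flips is nonpositive on a decreasing and
   an increasing function, which change in opposite directions at each flip. *)
Lemma jump_op_spin_mul_le v w x : cfg_decr v -> cfg_incr w ->
  jump_op (spin_rate lam mu) (fun z => v z * w z) x <=
  v x * jump_op (spin_rate lam mu) w x + w x * jump_op (spin_rate lam mu) v x.
Proof.
move=> vd wi; rewrite !jump_op_spin !mulr_sumr -big_split/=.
apply: ler_sum => i _; rewrite -subr_ge0.
set c := flip_rate i x; set v' := v (flip i x); set w' := w (flip i x).
have -> : v x * (c * (w' - w x)) + w x * (c * (v' - v x)) -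
    c * (v' * w' - v x * w x) = c * ((v x - v') * (w' - w x)) by ring.
have /andP[c0 _] := flip_rate_bd i x; rewrite mulr_ge0//.
case xi : (x i); last first.
  by rewrite mulr_ge0// subr_ge0; [apply/vd/le_flip|apply/wi/le_flip]; rewrite xi.
rewrite -mulrNN !opprB mulr_ge0// subr_ge0; [exact/vd/flip_le|exact/wi/flip_le].
Qed.

(** Writing [P] for the transition operators, [P_{s,r} (P_{r,t} v * P_{r,t} w)] interpolates between
    the product of the means at [r = s] and the mean of the product at [r = t]. It decreases in [r]:
    attractiveness keeps the two factors monotone in opposite directions, so [jump_op_spin_mul_le]
    applies at each time. *)
Lemma harris s t v w x : 0 <= s <= t ->
  (forall z, 0 <= v z <= 1) -> (forall z, 0 <= w z <= 1) ->
  cfg_decr v -> cfg_incr w ->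
  markov_op p s t (fun z => v z * w z) x <=
  markov_op p s t v x * markov_op p s t w x.
Proof.
move=> st v01 w01 vd wi; have /andP[s0 ts] := st.
have t0 := le_trans s0 ts.
pose Phi r := - markov_op p s r
  (fun z => markov_op p r t v z * markov_op p r t w z) x.
have Phis : Phi s = - (markov_op p s t v x * markov_op p s t w x).
  by rewrite /Phi (markov_op_id hp).
have Phit : Phi t = - markov_op p s t (fun z => v z * w z) x.
  by congr -%R; apply: eq_markov_op => z; rewrite !(markov_op_id hp).
rewrite -lerN2 -Phis -Phit.
(* The term [3 * C] comes from the expansions of [v'], [w'] and their product, the square from the
   product of the two increments, each at most [(K' + C) * h]. *)
pose K' := n%:R * K; pose D := 3 * C + (K' + C) ^+ 2.
have K'0 : 0 <= K' by apply: le_trans (jump_op_spin_bd x v01).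
have D0 : 0 <= D by rewrite addr_ge0 ?sqr_ge0// mulr_ge0.
apply: (nondecreasing_of_quadratic_defect ts D0) => r h sr /andP[h0 h1] rht.
have r0 := le_trans s0 sr.
have rh0 : 0 <= r + h by rewrite addr_ge0.
have srI : 0 <= s <= r by rewrite s0.
have rrh : r <= r + h by rewrite lerDl.
have rrhI : 0 <= r <= r + h by rewrite r0.
have rhtI : 0 <= r + h <= t by rewrite rh0.
set v' := markov_op p (r + h) t v; set w' := markov_op p (r + h) t w.
have v'01 z : 0 <= v' z <= 1 by exact: (markov_op_itv hp).
have w'01 z : 0 <= w' z <= 1 by exact: (markov_op_itv hp).
have vw'01 z : 0 <= v' z * w' z <= 1.
  have /andP[? ?] := v'01 z; have /andP[? ?] := w'01 z.
  by rewrite mulr_ge0//= mulr_ile1.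
have norm1 g : (forall z, 0 <= g z <= 1) -> forall z, `|g z| <= 1.
  by move=> g01 z; have /andP[g0 g1] := g01 z; rewrite ger0_norm.
have v'd : cfg_decr v' by exact: spin_decr.
have w'i : cfg_incr w' by exact: spin_incr.
rewrite /Phi -opprD lerN2 (markov_op_comp hp _ _ srI rrh) -/v' -/w'.
have {1}-> : D * h ^+ 2 = markov_op p s r (fun=> D * h ^+ 2) x.
  by rewrite (markov_op_cst hp).
rewrite -big_split/=.
under eq_bigr do rewrite -mulrDr.
apply: (markov_op_le hp) => // z.
rewrite !(markov_op_comp hp v z rrhI rht) !(markov_op_comp hp w z rrhI rht).
rewrite -/v' -/w'.
have := est z r0 h0 (norm1 _ vw'01); have := est z r0 h0 (norm1 _ v'01).
have := est z r0 h0 (norm1 _ w'01).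
have := jump_op_spin_bd z v'01; have := jump_op_spin_bd z w'01.
have := jump_op_spin_mul_le z v'd w'i.
move: (v'01 z) (w'01 z).
set a := markov_op p r (r + h) v' z; set b := markov_op p r (r + h) w' z.
set c := markov_op p r (r + h) _ z.
set Gv := jump_op _ v' z; set Gw := jump_op _ w' z; set Gvw := jump_op _ _ z.
move: (v' z) (w' z) => v0 w0 /andP[v00 v01'] /andP[w00 w01'] Gle Gwb Gvb.
move=> bE aE cE.
have small (u u0 Gu : R) : `|Gu| <= K' -> `|u - (u0 + h * Gu)| <= C * h ^+ 2 ->
    `|u - u0| <= (K' + C) * h.
  move=> Gub uE; have -> : u - u0 = (u - (u0 + h * Gu)) + h * Gu by ring.
  rewrite (le_trans (ler_normD _ _))// mulrDl addrC lerD//.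
    by rewrite normrM (ger0_norm h0) mulrC ler_wpM2r.
  by rewrite (le_trans uE)// ler_wpM2l// expr2 ler_piMl.
have prod_small : - ((K' + C) ^+ 2 * h ^+ 2) <= (a - v0) * (b - w0).
  rewrite lerNl (le_trans (ler_norm _))// normrN normrM -exprMn expr2.
  by rewrite ler_pM//; [exact: small aE|exact: small bE].
move: bE aE cE; rewrite !ler_norml => /andP[b1 b2] /andP[a1 a2] /andP[c1 c2].
have e0 : 0 <= C * h ^+ 2 by rewrite mulr_ge0 ?sqr_ge0.
have H1 : v0 * (h * Gw) - C * h ^+ 2 <= v0 * (b - w0).
  have : v0 * (h * Gw - C * h ^+ 2) <= v0 * (b - w0) by rewrite ler_wpM2l//; lra.
  have : v0 * (C * h ^+ 2) <= C * h ^+ 2 by rewrite ler_piMl.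
  by lra.
have H2 : w0 * (h * Gv) - C * h ^+ 2 <= w0 * (a - v0).
  have : w0 * (h * Gv - C * h ^+ 2) <= w0 * (a - v0) by rewrite ler_wpM2l//; lra.
  have : w0 * (C * h ^+ 2) <= C * h ^+ 2 by rewrite ler_piMl.
  by lra.
move: (ler_wpM2l h0 Gle) => Gle'.
have -> : a * b = v0 * w0 + v0 * (b - w0) + w0 * (a - v0) +
  (a - v0) * (b - w0) by ring.
rewrite /D mulrDl; lra.
Qed.

End Rates.
End SpinSemigroup.

(** * Jensen's inequality, first-order products and two-state chains *)

Section JensenOnCube.
Variables (R : realType) (n : nat).
Implicit Types (D : set 'rV[R]_n) (f : 'rV[R]_n -> R) (u v : 'rV[R]_n).

Lemma concave_onP D f u v (a : R) : concave_on D f -> D u -> D v ->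
  0 <= a <= 1 ->
  a * f u + (1 - a) * f v <= f (a *: u + (1 - a) *: v).
Proof.
move=> cf Du Dv /andP[a0 a1].
have := cf (Itv01 a0 a1) u v (mem_set Du) (mem_set Dv).
rewrite convRE /= !mulrN -opprD lerN2; exact.
Qed.

Lemma unit_cube_config (x : config n) : unit_cube (R := R) n (vec_of_config x).
Proof. by move=> j; rewrite mxE; case: (x j); rewrite lexx ler01. Qed.

Lemma unit_cube_conv u v (a : R) : unit_cube n u -> unit_cube n v ->
  0 <= a <= 1 -> unit_cube n (a *: u + (1 - a) *: v).
Proof.
move=> cu cv /andP[a0 a1] j; rewrite !mxE.
have /andP[u0 u1] := cu j; have /andP[v0 v1] := cv j.
have a'0 : 0 <= 1 - a by rewrite subr_ge0.
rewrite addr_ge0 ?mulr_ge0//=.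
have : a * u 0 j <= a by rewrite ler_piMr.
have : (1 - a) * v 0 j <= 1 - a by rewrite ler_piMr.
by lra.
Qed.

(** The point [m] is the barycenter, built by adding one configuration at a time. Its equations are
    multiplied by the total mass, so that mass 0 is allowed. *)
Lemma jensen_barycenter f (beta : config n -> R) (s : seq (config n)) :
  concave_on (unit_cube n) f -> (forall x, 0 <= beta x) ->
  exists m, [/\ unit_cube n m,
    \sum_(x <- s) beta x *: vec_of_config x = (\sum_(x <- s) beta x) *: m &
    \sum_(x <- s) beta x * f (vec_of_config x) <= (\sum_(x <- s) beta x) * f m].
Proof.
move=> cf b0; elim: s => [|x s [m [cm mE mle]]].
  exists 0; split; last by rewrite !big_nil mul0r.
    by move=> j; rewrite mxE lexx ler01.
  by rewrite !big_nil scale0r.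
rewrite !big_cons; set B := \sum_(y <- s) beta y in mE mle *.
have B0 : 0 <= B by apply: sumr_ge0.
have bx0 := b0 x.
have [B'0|B'0] := eqVneq (beta x + B) 0.
  have bxE : beta x = 0 by lra.
  have BE : B = 0 by lra.
  by exists m; rewrite bxE !add0r scale0r add0r mul0r add0r.
have B'gt0 : 0 < beta x + B by rewrite lt_neqAle eq_sym B'0 addr_ge0.
pose a := beta x / (beta x + B).
have a01 : 0 <= a <= 1.
  by rewrite divr_ge0 ?addr_ge0//= ler_pdivrMr// mul1r lerDl.
have aE : (beta x + B) * a = beta x by rewrite mulrC divfK.
have a'E : (beta x + B) * (1 - a) = B by rewrite mulrBr aE mulr1 addrC addKr.
clearbody a.
exists (a *: vec_of_config x + (1 - a) *: m); split.
- by apply: unit_cube_conv => //; exact: unit_cube_config.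
- by rewrite scalerDr !scalerA aE a'E mE.
- have := concave_onP cf (@unit_cube_config x) cm a01.
  rewrite -(ler_pM2l B'gt0) => /(le_trans _); apply.
  by rewrite [leRHS]mulrDr !mulrA aE a'E lerD2l.
Qed.

(** Jensen's inequality at the barycenter, which the last hypothesis places below [u], followed by
    monotonicity of [f]. *)
Lemma jensen_le f (beta : config n -> R) (u : 'rV[R]_n) :
  increasing_on (unit_cube n) f -> concave_on (unit_cube n) f ->
  (forall x, 0 <= beta x) -> unit_cube n u ->
  (forall k, \sum_x beta x * (x k)%:R <= (\sum_x beta x) * u 0 k) ->
  \sum_x beta x * f (vec_of_config x) <= (\sum_x beta x) * f u.
Proof.
move=> fi cf b0 cu le_u.
have [m [cm mE /le_trans]] := jensen_barycenter (index_enum (config n)) cf b0.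
apply; set B := \sum_x beta x in le_u mE *.
have : 0 <= B by apply: sumr_ge0.
rewrite le_eqVlt => /predU1P[<-|Bgt0]; first by rewrite !mul0r.
rewrite ler_wpM2l ?(ltW Bgt0)//; apply: fi => // k.
rewrite -(ler_pM2l Bgt0); apply: le_trans (le_u k).
have /rowP/(_ k) := mE; rewrite summxE !mxE => <-.
by apply: ler_sum => x _; rewrite !mxE.
Qed.

End JensenOnCube.

(** Product rule with quadratic remainder, by splitting off one factor at a time; the constant
    depends only on [n] and [K]. *)
Lemma prod_first_order (R : realType) (n : nat) (K : R) : 0 <= K ->
  exists2 C, 0 <= C & forall (a b c : 'I_n -> R) h, 0 <= h <= 1 ->
    (forall i, `|a i| <= 1) -> (forall i, `|b i| <= K) ->
    (forall i, `|c i - (a i + h * b i)| <= K * h ^+ 2) ->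
    `|\prod_i c i - (\prod_i a i + h * \sum_i b i * \prod_(k | k != i) a k)|
      <= C * h ^+ 2.
Proof.
move=> K0; elim: n => [|n [C C0 IHn]].
  exists 0 => // a b c h *; rewrite !big_ord0 mulr0 addr0 subrr normr0.
  by rewrite mul0r.
(* In order: the error of the first factor times the remaining product, the first factor times the
   inductive error, and the cross term of order [h ^+ 2]. *)
pose C' := K * (1 + n%:R * K + C) + (1 + K) * C + K * (n%:R * K).
have nK0 : 0 <= n%:R * K by rewrite mulr_ge0.
have C'0 : 0 <= C' by rewrite !addr_ge0// !mulr_ge0 ?addr_ge0.
exists C' => // a b c h h01 a1 bK cE; have /andP[h0 h1] := h01.
have prod1 m (P : pred 'I_m) (a' : 'I_m -> R) : (forall i, `|a' i| <= 1) ->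
    `|\prod_(i | P i) a' i| <= 1.
  by move=> a'1; rewrite normr_prod prodr_ile1// => i _; rewrite normr_ge0 a'1.
pose a' i := a (lift ord0 i); pose b' i := b (lift ord0 i).
pose c' i := c (lift ord0 i).
have IH := IHn a' b' c' h h01 (fun=> a1 _) (fun=> bK _) (fun=> cE _).
have sumE : \sum_i b i * \prod_(k | k != i) a k =
    b ord0 * \prod_i a' i + a ord0 * \sum_i b' i * \prod_(k | k != i) a' k.
  rewrite big_ord_recl mulr_sumr; congr (_ + _).
    by rewrite big_mkcond big_ord_recl/= mul1r; congr (_ * _); apply: eq_bigr.
  apply: eq_bigr => i _; rewrite mulrCA; congr (_ * _).
  rewrite big_mkcond big_ord_recl/= [X in _ = _ * X]big_mkcond.
  by congr (_ * _); apply: eq_bigr => k _; rewrite (inj_eq lift_inj).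
rewrite sumE !big_ord_recl -/(a' _).
have A1 : `|\prod_i a' i| <= 1 by apply: prod1 => i; exact: a1.
have B1 : `|\sum_i b' i * \prod_(k | k != i) a' k| <= n%:R * K.
  rewrite (le_trans (ler_norm_sum _ _ _))// -[X in X%:R]card_ord mulr_natl.
  rewrite -sumr_const ler_sum// => i _.
  by rewrite normrM -[leRHS]mulr1 ler_pM ?bK ?prod1// => j; exact: a1.
move: IH A1 B1; rewrite -/(\prod_i a' i) -/(\prod_i c' i).
set A := \prod_i a' i; set B := \sum_i _; set Cc := \prod_i c' i => IH A1 B1.
have -> : c ord0 * Cc - (a ord0 * A + h * (b ord0 * A + a ord0 * B)) =
   (c ord0 - (a ord0 + h * b ord0)) * Cc +
   (a ord0 + h * b ord0) * (Cc - (A + h * B)) + b ord0 * B * h ^+ 2 by ring.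
rewrite (le_trans (ler_normD _ _))// /C' [leRHS]mulrDl lerD//; last first.
  rewrite normrM (ger0_norm (sqr_ge0 h)) ler_wpM2r ?sqr_ge0//.
  by rewrite normrM ler_pM.
have h2 : C * h ^+ 2 <= C by rewrite ler_piMr// expr_le1.
have hle1 (z M : R) : `|z| <= M -> `|h * z| <= M.
  move=> zM; rewrite normrM (ger0_norm h0).
  by rewrite (le_trans _ zM)// ler_piMl.
rewrite (le_trans (ler_normD _ _))// [leRHS]mulrDl lerD//.
  rewrite normrM [leRHS]mulrAC ler_pM//.
  have -> : Cc = A + h * B + (Cc - (A + h * B)) by ring.
  rewrite (le_trans (ler_normD _ _))// lerD//; last exact: le_trans IH h2.
  by rewrite (le_trans (ler_normD _ _))// lerD// hle1.
rewrite normrM -mulrA ler_pM//.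
by rewrite (le_trans (ler_normD _ _))// lerD// hle1.
Qed.

(** * Monotonicity of two-state chains *)

Section SiteChain.
Variables (R : realType) (q : R -> bool -> bool -> R) (K : R).
Hypothesis q_bd : forall t a b, 0 <= t -> 0 <= q t a b <= K.
Variables (p : R -> R -> bool -> bool -> R) (C : R).
Hypothesis hp : transition_function q p.
Hypothesis C0 : 0 <= C.
Hypothesis est : short_time p q C.

Lemma jump_op_bool (r : bool -> bool -> R) (f : bool -> R) (a : bool) :
  jump_op r f a = r a (~~ a) * (f (~~ a) - f a).
Proof. by rewrite /jump_op big_bool; case: a; rewrite /= subrr mulr0 ?addr0 ?add0r. Qed.

Lemma jump_op_bool_bd t (f : bool -> R) a : 0 <= t -> (forall b, 0 <= f b <= 1) ->
  `|jump_op (q t) f a| <= K.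
Proof.
move=> t0 f01; rewrite jump_op_bool normrM.
have /andP[r0 rK] := q_bd a (~~ a) t0.
rewrite (ger0_norm r0) -[leRHS]mulr1 ler_pM// ler_norml.
by move: (f01 a) (f01 (~~ a)) => /andP[? ?] /andP[? ?]; apply/andP; split; lra.
Qed.

(** An Euler step multiplies [g false - g true] by 1 minus [h] times the sum of the two rates, which
    is nonnegative for small [h]. *)
Lemma site_chain_decr s t (f : bool -> R) : 0 <= s <= t ->
  (forall b, 0 <= f b <= 1) -> f true <= f false ->
  markov_op p s t f true <= markov_op p s t f false.
Proof.
move=> st f01 fd.
have K0 : 0 <= K by have /andP[/le_trans] := q_bd true true (lexx 0); apply.
pose h0 := (1 + 2 * K)^-1.
have h0V : 0 < 1 + 2 * K by rewrite ltr_wpDr// mulr_ge0.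
pose cone (g : bool -> R) := g true <= g false /\ forall z, 0 <= g z <= 1.
apply: (markov_op_euler_cone_le hp (h0 := h0) (K := cone) est) => //.
- by rewrite invr_gt0.
- by move=> g [_ g01] z; have /andP[g0 g1] := g01 z; rewrite ger0_norm.
- move=> u h g u0 /andP[h_ge0 hh0] [gd g01].
  have hK : h + h * K * 2 <= 1.
    have : h * (1 + 2 * K) <= 1 by rewrite -ler_pdivlMr ?div1r.
    by lra.
  have hr a b : 0 <= h * q u a b <= h * K.
    by have /andP[r0 rK] := q_bd a b u0; rewrite mulr_ge0//= ler_wpM2l.
  have hKh : h * K <= 2^-1 by lra.
  move: (hr false true) (hr true false) (g01 true) (g01 false).
  rewrite /cone !jump_op_bool /=.
  set l := h * q u false true; set m := h * q u true false.
  move=> /andP[l0 lK] /andP[m0 mK] /andP[gt0 gt1] /andP[gf0 gf1].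
  rewrite !mulrA -/l -/m.
  have d0 : 0 <= g false - g true by rewrite subr_ge0.
  have ml : m * (g false - g true) <= 2^-1 * (g false - g true).
    by rewrite ler_wpM2r//; lra.
  have ll : l * (g false - g true) <= 2^-1 * (g false - g true).
    by rewrite ler_wpM2r//; lra.
  have m_ge0 : 0 <= m * (g false - g true) by rewrite mulr_ge0.
  have l_ge0 : 0 <= l * (g false - g true) by rewrite mulr_ge0.
  split; first by lra.
  by move=> z; rewrite jump_op_bool !mulrA; case: z; rewrite /= -?/l -?/m;
    apply/andP; split; lra.
- by move=> g [].
Qed.

End SiteChain.

(** * Path probabilities of a Markov jump process *)

Section PathProbability.
Variables (R : realType) (S : finType).

(** For times nondecreasing from [s] on, the probability, starting from [x] at time [s], of meeting
    all observations in [L]. For a site chain this is the function [h_i] of the overview. *)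
Fixpoint path_prob (p : R -> R -> S -> S -> R) (s : R)
    (L : seq (R * pred S)) (x : S) : R :=
  if L is (t, f) :: L' then
    markov_op p s t (fun y => (f y)%:R * path_prob p t L' y) x
  else 1.

Lemma path_prob_itv q p s L x : transition_function q p -> 0 <= s ->
  path <=%R s (unzip1 L) -> 0 <= path_prob p s L x <= 1.
Proof.
move=> hp; elim: L s x => [|[t f] L IHL] s x s0 /=; first by rewrite ler01 lexx.
move=> /andP[st tL]; have t0 := le_trans s0 st.
apply: (markov_op_itv hp); first by rewrite s0.
by move=> y; have := IHL t y t0 tL; case: (f y); rewrite ?mul1r// mul0r lexx ler01.
Qed.

Variables (d : measure_display) (T : measurableType d) (P : probability T R).
Variables (X : R -> T -> S).
Hypothesis mX : forall t x, 0 <= t -> measurable [set w | X t w = x].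

Lemma measurable_state_pred t (f : pred S) : 0 <= t ->
  measurable [set w | f (X t w)].
Proof.
move=> t0.
rewrite (_ : mkset _ = \bigcup_(y in [set y | f y]) [set w | X t w = y]).
  by apply: fin_bigcup_measurable => [|y _]; [exact: finite_finset|exact: mX].
apply/seteqP; split=> [w fw|w [y /= fy ->]//]; by exists (X t w).
Qed.

Lemma measurable_past (l : seq (R * S)) :
  (forall a, a \in l -> 0 <= a.1) ->
  measurable [set w | forall a, a \in l -> X a.1 w = a.2].
Proof.
elim: l => [|a l IHl] l0.
  by rewrite (_ : mkset _ = setT)//; apply/seteqP.
rewrite (_ : mkset _ = [set w | X a.1 w = a.2] `&`
    [set w | forall b, b \in l -> X b.1 w = b.2]).
  apply: measurableI; first by apply: mX; rewrite l0// mem_head.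
  by apply: IHl => b bl; rewrite l0// in_cons bl orbT.
apply/seteqP; split=> [w h|w [h1 h2] b]; last first.
  by rewrite in_cons => /predU1P[->|/h2].
split=> [|b bl]; apply: h; first exact: mem_head.
by rewrite in_cons bl orbT.
Qed.

Lemma measurable_future (L : seq (R * pred S)) :
  (forall t, t \in unzip1 L -> 0 <= t) ->
  measurable [set w | all (fun b => b.2 (X b.1 w)) L].
Proof.
elim: L => [|b L IHL] /= L0; first by rewrite (_ : mkset _ = setT)//; apply/seteqP.
rewrite (_ : mkset _ = [set w | b.2 (X b.1 w)] `&`
    [set w | all (fun b => b.2 (X b.1 w)) L]).
  apply: measurableI; first by apply: measurable_state_pred; rewrite L0// mem_head.
  by apply: IHL => t tL; rewrite L0// in_cons tL orbT.
by apply/seteqP; split=> w /= => [/andP[]|[-> ->]].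
Qed.

Lemma measure_split_state (E : set T) t : measurable E -> 0 <= t ->
  P E = (\sum_y P (E `&` [set w | X t w = y]))%E.
Proof.
move=> mE t0.
have EE : E = \bigcup_(y in [set: S]) (E `&` [set w | X t w = y]).
  by apply/seteqP; split=> [w Ew|w [y _ []]//]; exists (X t w).
rewrite {1}EE measure_fin_bigcup.
- rewrite [RHS]fsbig_seq ?index_enum_uniq//; apply: eq_fsbigl.
  by apply/seteqP; split=> y //= _; rewrite mem_index_enum.
- exact: finite_finset.
- by move=> y z _ _ [w [[_ /= wy] [_ /= wz]]]; rewrite -wy -wz.
- by move=> y _; apply: measurableI => //; exact: mX.
Qed.

Variables (q : R -> S -> S -> R) (p : R -> R -> S -> S -> R).
Hypothesis markov : forall (l : seq (R * S)) s t x y, 0 <= s <= t ->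
  (forall a, a \in l -> 0 <= a.1 <= s) ->
  (P [set w | [/\ forall a, a \in l -> X a.1 w = a.2, X s w = x & X t w = y]] =
   P [set w | (forall a, a \in l -> X a.1 w = a.2) /\ X s w = x] *
   (p s t x y)%:E)%E.

(** Conditioning on the exact state at the first observation time moves [(s, x)] into the past, so
    the induction needs an arbitrary past [l]. *)
Lemma markov_path (l : seq (R * S)) s x (L : seq (R * pred S)) :
  0 <= s -> path <=%R s (unzip1 L) -> (forall a, a \in l -> 0 <= a.1 <= s) ->
  (P [set w | ((forall a, a \in l -> X a.1 w = a.2) /\ X s w = x) /\
              all (fun b => b.2 (X b.1 w)) L] =
   P [set w | (forall a, a \in l -> X a.1 w = a.2) /\ X s w = x] *
   (path_prob p s L x)%:E)%E.
Proof.
elim: L l s x => [|[t f] L IHL] l s x s0 /=.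
  move=> _ _; rewrite mule1; congr (P _).
  by apply/seteqP; split=> w /= => [[]|].
move=> /andP[st tL] ls; have t0 := le_trans s0 st.
have lt0 : forall u, u \in unzip1 L -> 0 <= u.
  by move: tL; rewrite path_sortedE; [|exact: le_trans];
    move=> /andP[/allP tu _] u /tu; exact: le_trans.
have mpast : measurable
    [set w | (forall a, a \in l -> X a.1 w = a.2) /\ X s w = x].
  apply: measurableI; last exact: mX.
  by apply: measurable_past => a /ls /andP[].
have mE : measurable [set w | ((forall a, a \in l -> X a.1 w = a.2) /\ X s w = x)
    /\ f (X t w) && all (fun b => b.2 (X b.1 w)) L].
  apply: measurableI => //.
  apply: (@measurable_future ((t, f) :: L)) => u.
  by rewrite in_cons => /predU1P[->//|]; exact: lt0.
rewrite (measure_split_state mE t0).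
have [r rE] : exists r : R, P [set w | (forall a, a \in l -> X a.1 w = a.2) /\
    X s w = x] = r%:E.
  by exists (fine (P [set w | (forall a, a \in l -> X a.1 w = a.2) /\
    X s w = x])); rewrite fineK// fin_num_measure.
rewrite rE; transitivity ((\sum_y
    r * (p s t x y * ((f y)%:R * path_prob p t L y)))%:E); last by rewrite -mulr_sumr.
rewrite -sumEFin; apply: eq_bigr => y _.
have l'0 a : a \in (s, x) :: l -> 0 <= a.1 <= t.
  rewrite in_cons => /predU1P[->/=|/ls /andP[-> /le_trans]]; first by rewrite s0.
  exact.
have pastE : [set w | (forall a, a \in (s, x) :: l -> X a.1 w = a.2) /\ X t w = y]
  = [set w | [/\ forall a, a \in l -> X a.1 w = a.2, X s w = x & X t w = y]].
  apply/seteqP; split=> [w [h1 h2]|w [h1 h2 h3]]; split=> //.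
  - by move=> a al; apply: h1; rewrite in_cons al orbT.
  - exact: (h1 (s, x) (mem_head _ _)).
  - by move=> a; rewrite in_cons => /predU1P[->|/h1].
case fy : (f y); last first.
  rewrite mul0r !mulr0 (_ : _ `&` _ = set0) ?measure0//.
  by apply/seteqP; split=> w //= [[_ /andP[+ _]] wy]; rewrite wy fy.
have st' : 0 <= s <= t by rewrite s0.
have := IHL _ _ y t0 tL l'0; rewrite pastE (markov _ _ st' ls).
rewrite rE mul1r mulrA => IH; transitivity ((r * p s t x y)%:E *
  (path_prob p t L y)%:E)%E; last by [].
rewrite -[RHS]IH; congr (P _); apply/seteqP; split=> w /=.
  move=> [[[h1 h2] /andP[_ h3]] wy]; split=> //; split=> //.
  by move=> a; rewrite in_cons => /predU1P[->|/h1].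
move=> [[h1 wy] h2]; rewrite wy fy; split=> //; split=> //; split.
  by move=> a al; apply: h1; rewrite in_cons al orbT.
exact: (h1 (s, x) (mem_head _ _)).
Qed.

Lemma markov_path_from (x0 : S) (L : seq (R * pred S)) :
  P [set w | X 0 w = x0] = 1%E -> path <=%R 0 (unzip1 L) ->
  P [set w | all (fun b => b.2 (X b.1 w)) L] = (path_prob p 0 L x0)%:E.
Proof.
move=> P0 L0.
have lt0 : forall u, u \in unzip1 L -> 0 <= u.
  by move: L0; rewrite path_sortedE; [|exact: le_trans]; move=> /andP[/allP].
have mE := measurable_future lt0.
have nil0 a : a \in ([::] : seq (R * S)) -> 0 <= a.1 <= 0 by [].
have startE x : [set w | (forall a, a \in ([::] : seq (R * S)) -> X a.1 w = a.2)
    /\ X 0 w = x] = [set w | X 0 w = x].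
  by apply/seteqP; split=> w /= => [[]|].
have term x : P ([set w | all (fun b => b.2 (X b.1 w)) L] `&`
    [set w | X 0 w = x]) = (P [set w | X 0 w = x] * (path_prob p 0 L x)%:E)%E.
  rewrite -[in RHS]startE -(markov_path _ (lexx 0) L0 nil0); congr (P _).
  by apply/seteqP; split=> w /= => [[h1 h2]|[[_ h2] h1]].
rewrite (measure_split_state mE (lexx 0)) (bigD1 x0)//= big1 ?adde0.
  by rewrite term P0 mul1e.
move=> x xx0; rewrite term.
(* Starting at [x] lies in the complement of an event of probability 1. *)
suff -> : P [set w | X 0 w = x] = 0%E by rewrite mul0e.
apply/eqP; rewrite eq_le measure_ge0 andbT.
have := @probability_setC _ _ _ P _ (mX x0 (lexx 0)).
rewrite [X in (_ - X)%E]P0 subee// => <-.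
apply: le_measure; rewrite ?inE.
- exact: mX.
- by apply: measurableC; exact: mX.
- by move=> w /= -> /eqP; apply/negP.
Qed.

End PathProbability.

(** * Comparison of the means with the deterministic process *)

Lemma rV_norm_le (R : realType) (n : nat) (u : 'rV[R]_n) (c : R) : 0 <= c ->
  (forall j, `|u 0 j| <= c) -> `|u| <= c.
Proof.
move=> c0 uc; rewrite /Num.norm/= mx_normrE; apply: bigmax_le => // -[i j] _ /=.
by rewrite ord1.
Qed.

Lemma lipschitz_on_cube (R : realType) (n : nat) (f : 'rV[R]_n -> R) :
  [lipschitz (f x : R^o) | x in unit_cube n] ->
  exists L, forall x y, unit_cube n x -> unit_cube n y ->
    `|f x - f y| <= L * `|x - y|.
Proof.
rewrite /lipschitz_on => /(@filter_ex R (pinfty_nbhs R) _)[L fL].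
exists L => x y cx cy.
exact: (fL (x, y) (conj cx cy)).
Qed.

Section Rates.
Variables (R : realType) (n : nat) (lam mu : 'I_n -> config n -> R).
Variables (lamx mux : 'I_n -> 'rV[R]_n -> R) (K : R).
Hypothesis hlam_ext : forall i x, lamx i (vec_of_config x) = lam i x.
Hypothesis hmu_ext : forall i x, mux i (vec_of_config x) = mu i x.
Hypothesis K0 : 0 <= K.
Hypothesis lamx_bd : forall i x, unit_cube n x -> 0 <= lamx i x <= K.
Hypothesis mux_bd : forall i x, unit_cube n x -> 0 <= mux i x <= K.
Hypothesis lamx_lip : forall i x y, unit_cube n x -> unit_cube n y ->
  `|lamx i x - lamx i y| <= K * `|x - y|.
Hypothesis mux_lip : forall i x y, unit_cube n x -> unit_cube n y ->
  `|mux i x - mux i y| <= K * `|x - y|.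
Hypothesis hlam_incr : forall i, increasing_on (unit_cube n) (lamx i).
Hypothesis hmu_decr : forall i, decreasing_on (unit_cube n) (mux i).
Hypothesis hmu_conv : forall i, convex_on (unit_cube n) (mux i).
Hypothesis hsum_incr : forall i,
  increasing_on (unit_cube n) (fun x => lamx i x + mux i x).
Hypothesis hsum_conc : forall i,
  concave_on (unit_cube n) (fun x => lamx i x + mux i x).

Implicit Types (x y z : config n) (u v : 'rV[R]_n).

Lemma lam_bd i x : 0 <= lam i x <= K.
Proof. by rewrite -hlam_ext lamx_bd//; exact: unit_cube_config. Qed.

Lemma mu_bd i x : 0 <= mu i x <= K.
Proof. by rewrite -hmu_ext mux_bd//; exact: unit_cube_config. Qed.

Lemma vec_le x y : cfg_le x y ->
  forall j, (vec_of_config x : 'rV[R]_n) 0 j <= (vec_of_config y : 'rV[R]_n) 0 j.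
Proof.
move=> xy j; rewrite !mxE ler_nat.
by case xj : (x j) => //; rewrite (xy _ xj).
Qed.

Lemma lam_cfg_incr i : cfg_incr (lam i).
Proof.
by move=> x y xy; rewrite -!hlam_ext; apply: hlam_incr;
  [exact: unit_cube_config..|exact: vec_le].
Qed.

Lemma mu_cfg_decr i : cfg_decr (mu i).
Proof.
by move=> x y xy; rewrite -!hmu_ext; apply: hmu_decr;
  [exact: unit_cube_config..|exact: vec_le].
Qed.

Definition drift i u : R := (1 - u 0 i) * lamx i u - u 0 i * mux i u.

(** In this form a nonnegative factor multiplies an increasing concave function and a decreasing
    convex one is subtracted, which suits both monotonicity and Jensen's inequality. *)
Lemma driftE i u : drift i u = (1 - u 0 i) * (lamx i u + mux i u) - mux i u.
Proof. by rewrite /drift; ring. Qed.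

Lemma drift_bd i u : unit_cube n u -> `|drift i u| <= K.
Proof.
move=> cu; have /andP[u0 u1] := cu i.
have /andP[l0 lK] := lamx_bd i cu; have /andP[m0 mK] := mux_bd i cu.
have u'0 : 0 <= 1 - u 0 i by rewrite subr_ge0.
have H1 : (1 - u 0 i) * lamx i u <= (1 - u 0 i) * K by rewrite ler_wpM2l.
have H2 : u 0 i * mux i u <= u 0 i * K by rewrite ler_wpM2l.
have H3 : 0 <= (1 - u 0 i) * lamx i u by rewrite mulr_ge0.
have H4 : 0 <= u 0 i * mux i u by rewrite mulr_ge0.
have H5 : 0 <= u 0 i * K by rewrite mulr_ge0.
have H6 : 0 <= (1 - u 0 i) * K by rewrite mulr_ge0.
by rewrite ler_norml /drift; apply/andP; split; lra.
Qed.

(* Quasimonotonicity of the drift, in the form used for an Euler step. *)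
Lemma euler_drift_mono i h u v : unit_cube n u -> unit_cube n v -> 0 <= h ->
  h * (2 * K) <= 1 -> (forall j, u 0 j <= v 0 j) ->
  u 0 i + h * drift i u <= v 0 i + h * drift i v.
Proof.
move=> cu cv h0 hK uv; rewrite !driftE.
have /andP[u0 u1] := cu i; have /andP[v0 v1] := cv i.
have /andP[l0 lK] := lamx_bd i cu; have /andP[m0 mK] := mux_bd i cu.
have H1 : h * mux i v <= h * mux i u by rewrite ler_wpM2l// hmu_decr.
have H2 : (h * (1 - v 0 i)) * (lamx i u + mux i u) <=
          (h * (1 - v 0 i)) * (lamx i v + mux i v).
  by rewrite ler_wpM2l ?mulr_ge0 ?subr_ge0//; exact: hsum_incr.
have H3 : (v 0 i - u 0 i) * (h * (lamx i u + mux i u)) <= v 0 i - u 0 i.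
  rewrite ler_piMr ?subr_ge0//; apply: le_trans hK; rewrite ler_wpM2l//; lra.
by lra.
Qed.

(** Raising coordinate [i] itself only lowers the drift; the change of [lamx i + mux i] costs
    [2 * K * c] and that of [mux i] costs [K * c]. *)
Lemma drift_le i u v (c : R) : unit_cube n u -> unit_cube n v ->
  (forall j, u 0 j <= v 0 j) -> `|v - u| <= c ->
  drift i v <= drift i u + 3 * K * c.
Proof.
move=> cu cv uv uvc; rewrite !driftE.
have /andP[u0 u1] := cu i; have /andP[v0 v1] := cv i.
have /andP[lv0 lvK] := lamx_bd i cv; have /andP[mv0 mvK] := mux_bd i cv.
have Kc : K * `|v - u| <= K * c by rewrite ler_wpM2l.
have Kc0 : 0 <= K * c by rewrite mulr_ge0// (le_trans _ uvc).
have := le_trans (lamx_lip i cv cu) Kc; have := le_trans (mux_lip i cv cu) Kc.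
rewrite !ler_norml => /andP[m1 m2] /andP[l1 l2].
have H1 : 0 <= (v 0 i - u 0 i) * (lamx i v + mux i v).
  by rewrite mulr_ge0 ?subr_ge0// addr_ge0.
have H2 : (1 - u 0 i) * (lamx i v + mux i v - lamx i u - mux i u) <=
    (1 - u 0 i) * (2 * (K * c)).
  by rewrite ler_wpM2l ?subr_ge0//; lra.
have H3 : (1 - u 0 i) * (2 * (K * c)) <= 2 * (K * c).
  by rewrite ler_piMl//; lra.
by lra.
Qed.

Definition coord_drift i x : R := if x i then - mu i x else lam i x.

Lemma coord_driftE i x : coord_drift i x = (1 - (x i)%:R) *
    (lamx i (vec_of_config x) + mux i (vec_of_config x)) - mux i (vec_of_config x).
Proof. by rewrite /coord_drift hlam_ext hmu_ext; case: (x i) => /=; ring. Qed.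

(** Jensen's inequality for [lamx i + mux i] under the weights restricted to [x i = 0], and for
    [- mux i] under [beta]; the last two hypotheses are the corresponding barycenter conditions. *)
Lemma coord_drift_sum_le i (beta : config n -> R) u : (forall x, 0 <= beta x) ->
  unit_cube n u ->
  (forall k, \sum_x beta x * (x k)%:R <= (\sum_x beta x) * u 0 k) ->
  (forall k, \sum_x beta x * (1 - (x i)%:R) * (x k)%:R <=
             (\sum_x beta x * (1 - (x i)%:R)) * u 0 k) ->
  \sum_x beta x * coord_drift i x <=
  (\sum_x beta x * (1 - (x i)%:R)) * (lamx i u + mux i u) -
  (\sum_x beta x) * mux i u.
Proof.
move=> b0 cu le1 le2.
under eq_bigr do rewrite coord_driftE mulrBr mulrA.
rewrite sumrB lerB//.
  apply: (jensen_le (f := fun u => lamx i u + mux i u)) => //.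
  by move=> x; rewrite mulr_ge0// subr_ge0; case: (x i); rewrite ?lexx ?ler01.
rewrite -lerN2 -mulrN -sumrN.
under eq_bigr do rewrite -mulrN.
apply: (jensen_le (f := fun u => - mux i u)) => //.
  by move=> x y cx cy xy; rewrite lerN2; exact: hmu_decr.
rewrite /concave_on (_ : (fun v => _) = mux i)//.
by apply/funext => v; rewrite opprK.
Qed.

Section Deterministic.
Variables (x0 : config n) (p : R -> 'rV[R]_n).
Hypothesis hp : deterministic_process lamx mux x0 p.

Lemma deterministic_cube t : 0 <= t -> unit_cube n (p t).
Proof. by case: hp => + _ _; apply. Qed.

Lemma deterministic_lip s t : 0 <= s <= t -> `|p t - p s| <= K * (t - s).
Proof.
move=> /andP[s0 st]; have [cp _ dp] := hp.
apply: rV_norm_le => [|j]; first by rewrite mulr_ge0// subr_ge0.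
have := has_derivative_from_increment (c := 0) (K := K) (dp j) s0 st.
rewrite mulr0 subr0 !mxE; apply=> u /andP[su _].
by rewrite subr0; apply: drift_bd; apply: cp; rewrite (le_trans s0)// ltW.
Qed.

Lemma lamx_deterministic_lip i s t : 0 <= s <= t ->
  `|lamx i (p t) - lamx i (p s)| <= K ^+ 2 * (t - s).
Proof.
move=> st; have /andP[s0 ts] := st; have t0 := le_trans s0 ts.
rewrite (le_trans (lamx_lip _ (deterministic_cube t0) (deterministic_cube s0)))//.
by rewrite expr2 -mulrA ler_wpM2l// deterministic_lip.
Qed.

Lemma mux_deterministic_lip i s t : 0 <= s <= t ->
  `|mux i (p t) - mux i (p s)| <= K ^+ 2 * (t - s).
Proof.
move=> st; have /andP[s0 ts] := st; have t0 := le_trans s0 ts.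
rewrite (le_trans (mux_lip _ (deterministic_cube t0) (deterministic_cube s0)))//.
by rewrite expr2 -mulrA ler_wpM2l// deterministic_lip.
Qed.

Lemma drift_deterministic_lip i s t : 0 <= s <= t ->
  `|drift i (p t) - drift i (p s)| <= 5 * K ^+ 2 * (t - s).
Proof.
move=> st; have /andP[s0 ts] := st; have t0 := le_trans s0 ts.
have cs := deterministic_cube s0; have ct := deterministic_cube t0.
have := lamx_deterministic_lip i st; have := mux_deterministic_lip i st.
have pl : `|p t 0 i - p s 0 i| <= K * (t - s).
  have [_ _ dp] := hp.
  have := has_derivative_from_increment (c := 0) (K := K) (dp i) s0 ts.
  rewrite mulr0 subr0; apply=> u /andP[su _]; rewrite subr0.
  by apply: drift_bd; apply: deterministic_cube; rewrite (le_trans s0)// ltW.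
have /andP[l0 lK] := lamx_bd i ct; have /andP[m0 mK] := mux_bd i ct.
set e := K ^+ 2 * (t - s).
have e0 : 0 <= e by rewrite mulr_ge0 ?sqr_ge0// subr_ge0.
move=> mE lE; rewrite -mulrA -/e.
set sg := lamx i (p t) + mux i (p t) - lamx i (p s) - mux i (p s).
(* The constant 5 is 1 for [lamx], 2 for the change of coordinate [i] against a total rate of at
   most [2 * K], and 2 for the change of the total rate. *)
have -> : drift i (p t) - drift i (p s) =
  (lamx i (p t) - lamx i (p s)) -
  ((p t 0 i - p s 0 i) * (lamx i (p t) + mux i (p t)) + p s 0 i * sg).
  by rewrite /drift /sg; ring.
have H1 : `|(p t 0 i - p s 0 i) * (lamx i (p t) + mux i (p t))| <= 2 * e.
  have -> : 2 * e = (K * (t - s)) * (2 * K) by rewrite /e; ring.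
  by rewrite normrM ler_pM// ger0_norm ?addr_ge0//; lra.
have H2 : `|p s 0 i * sg| <= 2 * e.
  have /andP[q0 q1] := cs i; rewrite normrM ger0_norm//.
  apply: (@le_trans _ _ `|sg|); first by rewrite ler_piMl.
  have -> : sg = (lamx i (p t) - lamx i (p s)) + (mux i (p t) - mux i (p s)).
    by rewrite /sg; ring.
  by rewrite (le_trans (ler_normD _ _))//; lra.
rewrite (le_trans (ler_normB _ _))// (@le_trans _ _ (e + (2 * e + 2 * e)))//.
  by rewrite lerD// (le_trans (ler_normD _ _))// lerD.
by lra.
Qed.

Lemma deterministic_euler i s h : 0 <= s -> 0 <= h ->
  `|p (s + h) 0 i - p s 0 i - h * drift i (p s)| <= 5 * K ^+ 2 * h ^+ 2.
Proof.
move=> s0 h0; have [_ _ dp] := hp.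
have ssh : s <= s + h by rewrite lerDl.
have := has_derivative_from_increment (c := drift i (p s))
  (K := 5 * K ^+ 2 * h) (dp i) s0 ssh.
have -> : s + h - s = h by ring.
move=> H; have -> : 5 * K ^+ 2 * h ^+ 2 = 5 * K ^+ 2 * h * h by ring.
apply: H => u /andP[su uh].
have su' : 0 <= s <= u by rewrite s0 ltW.
apply: le_trans (drift_deterministic_lip i su') _.
by rewrite ler_wpM2l ?mulr_ge0 ?sqr_ge0// lerBlDl ltW.
Qed.

Variable pX : R -> R -> config n -> config n -> R.
Hypothesis hpX : transition_function (fun=> spin_rate lam mu) pX.
Variable C : R.
Hypothesis C0 : 0 <= C.
Hypothesis est : short_time pX (fun=> spin_rate lam mu) C.

Definition coord i x : R := (x i)%:R.

Lemma coord01 i x : 0 <= coord i x <= 1.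
Proof. by rewrite /coord; case: (x i); rewrite lexx ler01. Qed.

Lemma coord_incr i : cfg_incr (coord i).
Proof.
move=> x y xy; rewrite /coord ler_nat.
by case xi : (x i) => //; rewrite (xy _ xi).
Qed.

Lemma jump_op_coord i x :
  jump_op (spin_rate lam mu) (coord i) x = coord_drift i x.
Proof.
rewrite jump_op_spin (bigD1 i)//= big1 ?addr0 => [|j ji].
  rewrite /coord flip_same /flip_rate /coord_drift.
  by case: (x i) => /=; rewrite ?sub0r ?subr0 ?mulrN1 ?mulr1.
by rewrite /coord flip_other 1?eq_sym// subrr mulr0.
Qed.

Definition mean t : 'rV[R]_n := \row_j markov_op pX 0 t (coord j) x0.

Lemma mean_cube t : 0 <= t -> unit_cube n (mean t).
Proof.
move=> t0 j; rewrite mxE; apply: (markov_op_itv hpX); last exact: coord01.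
by apply/andP; split.
Qed.

(** Harris' inequality for [1 - coord j] and [coord k] supplies the barycenter condition under which
    the averaged drift is at most the drift at the mean. *)
Lemma mean_euler j r h : 0 <= r -> 0 <= h ->
  mean (r + h) 0 j <= mean r 0 j + h * drift j (mean r) + C * h ^+ 2.
Proof.
move=> r0 h0; have r0I : (0 : R) <= 0 <= r by apply/andP; split.
have rrh : r <= r + h by rewrite lerDl.
rewrite {1}mxE (markov_op_comp hpX _ _ r0I rrh).
apply: (@le_trans _ _ (markov_op pX 0 r (fun x => coord j x +
    h * coord_drift j x + C * h ^+ 2) x0)).
  apply: (markov_op_le hpX) => // x; rewrite -lerBlDl -jump_op_coord.
  have c1 y : `|coord j y| <= 1.
    by have /andP[? ?] := coord01 j y; rewrite ger0_norm.
  by have := est x r0 h0 c1; rewrite ler_norml => /andP[].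
have -> : markov_op pX 0 r (fun x => coord j x + h * coord_drift j x +
    C * h ^+ 2) x0 = mean r 0 j + h * markov_op pX 0 r (coord_drift j) x0 +
    C * h ^+ 2.
  rewrite -[X in _ = _ + X](markov_op_cst hpX (C * h ^+ 2) x0 r0I) mxE.
  rewrite /markov_op mulr_sumr -!big_split/=; apply: eq_bigr => y _; ring.
rewrite lerD2r lerD2l ler_wpM2l// /markov_op.
have b0 x : 0 <= pX 0 r x0 x by exact: (transition_ge0 hpX).
have b1 := transition_sum1 hpX x0 r0I.
apply: le_trans (coord_drift_sum_le b0 (mean_cube r0) _ _) _.
- by move=> k; rewrite b1 mul1r mxE.
- move=> k; rewrite mxE.
  have v01 x : 0 <= 1 - coord j x <= 1.
    by have /andP[? ?] := coord01 j x; apply/andP; split; lra.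
  have vd : cfg_decr (fun x => 1 - coord j x).
    by move=> x y xy; rewrite lerD2l lerN2 coord_incr.
  have := harris lam_bd mu_bd lam_cfg_incr mu_cfg_decr hpX C0 est x0 r0I v01
    (coord01 k) vd (@coord_incr k).
  by rewrite /markov_op; under eq_bigr do rewrite mulrA.
- rewrite driftE b1 mul1r.
  under eq_bigr do rewrite mulrBr mulr1.
  by rewrite sumrB b1 mxE.
Qed.

(** Gronwall's inequality for the largest positive part of [mean - p]; starting the maximum at 0
    makes [delta] nonnegative. *)
Lemma mean_le_deterministic t j : 0 <= t -> mean t 0 j <= p t 0 j.
Proof.
move=> t0; pose delta r := \big[Num.max/0]_k (mean r 0 k - p r 0 k).
have delta_ge0 r : 0 <= delta r by exact: bigmax_ge_id.
have delta_ub r k : mean r 0 k - p r 0 k <= delta r by exact: le_bigmax.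
suff dt : delta t <= 0 by rewrite -subr_le0 (le_trans (delta_ub t j)).
have K1 : 0 < 1 + 2 * K by rewrite ltr_wpDr// mulr_ge0.
apply: (@discrete_gronwall _ delta 0 t (3 * K) (C + 5 * K ^+ 2) (1 + 2 * K)^-1) => //.
- by rewrite mulr_ge0.
- by rewrite addr_ge0// mulr_ge0// sqr_ge0.
- by rewrite invr_gt0.
- apply: bigmax_le => // k _; have [_ p0 _] := hp.
  by rewrite p0 !mxE (markov_op_id hpX)// subrr.
move=> r h r0 /andP[h0 hh0] _.
have hK : h * (2 * K) <= 1.
  have : h * (1 + 2 * K) <= 1 by rewrite -ler_pdivlMr ?div1r.
  by rewrite mulrDr; lra.
have cp := deterministic_cube r0; have cm := mean_cube r0.
have d0 := delta_ge0 r.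
have Kh0 : 0 <= 3 * K * h by rewrite !mulr_ge0.
have h2 : 0 <= h ^+ 2 := sqr_ge0 h.
apply: bigmax_le => [|k _].
  rewrite addr_ge0// ?mulr_ge0 ?addr_ge0//.
  by rewrite mulr_ge0// sqr_ge0.
(* Quasimonotonicity compares [mean r] with [z], which lies above it, and [drift_le] compares [z]
   with [p r], at distance at most [delta r]. *)
pose z : 'rV[R]_n := \row_i Num.max (p r 0 i) (mean r 0 i).
have cz : unit_cube n z.
  by move=> i; rewrite mxE; case: (leP (p r 0 i) (mean r 0 i)).
have pz i : p r 0 i <= z 0 i.
  by rewrite [z 0 i]mxE; case: (leP (p r 0 i) (mean r 0 i)).
have mz i : mean r 0 i <= z 0 i.
  by rewrite [z 0 i]mxE; case: (leP (p r 0 i) (mean r 0 i)) => // /ltW.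
have zp i : z 0 i - p r 0 i <= delta r.
  rewrite [z 0 i]mxE; case: (leP (p r 0 i) (mean r 0 i)) => _; first exact: delta_ub.
  by rewrite subrr.
have zpn : `|z - p r| <= delta r.
  apply: rV_norm_le => // i; have := zp i; have := pz i; rewrite !mxE.
  by move=> ? ?; rewrite ger0_norm// subr_ge0.
have H1 := mean_euler k r0 h0.
have H2 := euler_drift_mono k cm cz h0 hK mz.
have H3 := ler_wpM2l h0 (drift_le k cp cz pz zpn).
have := deterministic_euler k r0 h0; rewrite ler_norml => /andP[H4 _].
have H5 := zp k.
by lra.
Qed.

(** * Comparison of the path probabilities *)

Variables (pW : 'I_n -> R -> R -> bool -> bool -> R) (CW : R).
Hypothesis hpW : forall i, transition_function (site_rate lamx mux p i) (pW i).
Hypothesis CW0 : 0 <= CW.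
Hypothesis estW : forall i, short_time (pW i) (site_rate lamx mux p i) CW.

Lemma site_rate_bd i t a b : 0 <= t -> 0 <= site_rate lamx mux p i t a b <= K.
Proof.
move=> t0; have cp := deterministic_cube t0.
by case: a; case: b; rewrite /= ?lexx ?K0 ?(lamx_bd i cp) ?(mux_bd i cp).
Qed.

Lemma site_prod_itv (P : pred 'I_n) (u : 'I_n -> bool -> R) z :
  (forall i b, 0 <= u i b <= 1) -> 0 <= \prod_(i | P i) u i (z i) <= 1.
Proof.
move=> u01; apply/andP; split.
  by apply: prodr_ge0 => i _; case/andP: (u01 i (z i)).
by apply: prodr_ile1 => i _; exact: u01.
Qed.

Lemma site_prod_decr (P : pred 'I_n) (u : 'I_n -> bool -> R) :
  (forall i b, 0 <= u i b <= 1) -> (forall i, u i true <= u i false) ->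
  cfg_decr (fun z => \prod_(i | P i) u i (z i)).
Proof.
move=> u01 ud x y xy; apply: ler_prod => i _.
have /andP[-> _] := u01 i (y i); have := xy i.
by case: (x i) => [/(_ isT)->|_]; [|case: (y i)]; rewrite ?lexx ?ud.
Qed.

Lemma cfg_decr_mul (f g : config n -> R) :
  (forall x, 0 <= f x <= 1) -> (forall x, 0 <= g x <= 1) ->
  cfg_decr f -> cfg_decr g -> cfg_decr (fun x => f x * g x).
Proof.
move=> f01 g01 fd gd x y xy; have /andP[f0 _] := f01 y; have /andP[g0 _] := g01 y.
by rewrite ler_pM ?fd ?gd.
Qed.

Lemma mul_itv01 (a b : R) : 0 <= a <= 1 -> 0 <= b <= 1 -> 0 <= a * b <= 1.
Proof. by move=> /andP[? ?] /andP[? ?]; rewrite mulr_ge0//= mulr_ile1. Qed.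

Lemma vacant01 i x : 0 <= 1 - coord i x <= 1.
Proof. by have /andP[? ?] := coord01 i x; apply/andP; split; lra. Qed.

Lemma vacant_decr i : cfg_decr (fun x => 1 - coord i x).
Proof. by move=> x y xy; rewrite lerD2l lerN2 coord_incr. Qed.

(* The weights [beta] are the law of the process at time [s] on a decreasing
   event of its past; each increasing function is then negatively correlated
   with every decreasing one, when compared with its unconditional mean. *)
Definition neg_correlated s (beta : config n -> R) : Prop :=
  [/\ forall x, 0 <= beta x, \sum_x beta x <= 1 &
      forall f w, (forall x, 0 <= f x <= 1) -> (forall x, 0 <= w x <= 1) ->
        cfg_decr f -> cfg_incr w ->
        \sum_x beta x * (f x * w x) <=
        (\sum_x beta x * f x) * markov_op pX 0 s w x0].

Definition push s t (f beta : config n -> R) z : R :=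
  f z * \sum_y beta y * pX s t y z.

Lemma sum_push s t f beta (g : config n -> R) :
  \sum_z push s t f beta z * g z =
  \sum_y beta y * markov_op pX s t (fun z => f z * g z) y.
Proof.
rewrite /push /markov_op.
under eq_bigr do rewrite mulrAC mulr_sumr.
rewrite exchange_big/=; apply: eq_bigr => y _; rewrite mulr_sumr.
by apply: eq_bigr => z _; ring.
Qed.

(** Harris' inequality on [[s, t]] separates [f * g] from [w]; by attractiveness the transported
    functions remain decreasing and increasing, so the correlation at time [s] applies to them. *)
Lemma neg_correlated_push s t f beta : 0 <= s <= t ->
  (forall x, 0 <= f x <= 1) -> cfg_decr f ->
  neg_correlated s beta -> neg_correlated t (push s t f beta).
Proof.
move=> st f01 fd [b0 b1 bneg]; have /andP[s0 ts] := st; split.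
- move=> z; have /andP[fz0 _] := f01 z; rewrite mulr_ge0// sumr_ge0// => y _.
  by rewrite mulr_ge0// (transition_ge0 hpX).
- have -> : \sum_x push s t f beta x = \sum_x push s t f beta x * 1.
    by apply: eq_bigr => x _; rewrite mulr1.
  rewrite sum_push; apply: le_trans b1; apply: ler_sum => y _.
  rewrite ler_piMr//.
  have /andP[_ //] : 0 <= markov_op pX s t (fun z => f z * 1) y <= 1.
  by apply: (markov_op_itv hpX) => // z; rewrite mulr1.
- move=> g w g01 w01 gd wi; rewrite !sum_push.
  have fg01 x : 0 <= f x * g x <= 1 by exact: mul_itv01.
  have fgd := cfg_decr_mul f01 g01 fd gd.
  have s0I : (0 : R) <= 0 <= s by apply/andP; split.
  rewrite (markov_op_comp hpX w x0 s0I ts).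
  apply: le_trans (bneg _ _ _ _ _ _).
  + apply: ler_sum => y _; rewrite ler_wpM2l//.
    under eq_markov_op do rewrite mulrA.
    exact: (harris lam_bd mu_bd lam_cfg_incr mu_cfg_decr hpX C0 est).
  + by move=> y; apply: (markov_op_itv hpX).
  + by move=> y; apply: (markov_op_itv hpX).
  + exact: (spin_decr lam_bd mu_bd lam_cfg_incr mu_cfg_decr hpX C0 est).
  + exact: (spin_incr lam_bd mu_bd lam_cfg_incr mu_cfg_decr hpX C0 est).
Qed.

Lemma neg_correlated_coord s beta f k : 0 <= s -> neg_correlated s beta ->
  (forall x, 0 <= f x <= 1) -> cfg_decr f ->
  \sum_x beta x * f x * (x k)%:R <= (\sum_x beta x * f x) * p s 0 k.
Proof.
move=> s0 [b0 b1 bneg] f01 fd.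
under eq_bigr do rewrite -mulrA.
apply: le_trans (bneg _ _ f01 (coord01 k) fd (@coord_incr k)) _.
rewrite ler_wpM2l//.
  by apply: sumr_ge0 => x _; have /andP[? _] := f01 x; rewrite mulr_ge0.
by have := mean_le_deterministic k s0; rewrite mxE.
Qed.

(** For each site the product over the other sites is decreasing, so it can be absorbed into the
    weights, whose means remain below [p r], also after restriction to [x i = 0]. *)
Lemma generator_comparison r beta (u : 'I_n -> bool -> R) : 0 <= r ->
  neg_correlated r beta ->
  (forall i b, 0 <= u i b <= 1) -> (forall i, u i true <= u i false) ->
  0 <= \sum_z beta z * \sum_i
    (flip_rate lam mu i z - site_rate lamx mux p i r (z i) (~~ z i)) *
    (u i (~~ z i) - u i (z i)) * \prod_(k | k != i) u k (z k).
Proof.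
move=> r0 bneg u01 ud; have [b0 _ _] := bneg.
under eq_bigr do rewrite mulr_sumr.
rewrite exchange_big sumr_ge0//= => i _.
set f := fun z : config n => \prod_(k | k != i) u k (z k).
have f01 z : 0 <= f z <= 1 by exact: site_prod_itv.
have fd : cfg_decr f by exact: site_prod_decr.
set sp := lamx i (p r) + mux i (p r).
have termE z : beta z * ((flip_rate lam mu i z -
    site_rate lamx mux p i r (z i) (~~ z i)) * (u i (~~ z i) - u i (z i)) *
    \prod_(k | k != i) u k (z k)) =
  (u i false - u i true) * (beta z * f z * (1 - (z i)%:R) * sp -
    beta z * f z * mux i (p r) - beta z * f z * coord_drift i z).
  rewrite -/(f z) /flip_rate /coord_drift /sp.
  by case: (z i) => /=; ring.
under eq_bigr do rewrite termE.
rewrite -mulr_sumr mulr_ge0 ?subr_ge0// !sumrB -!mulr_suml subr_ge0.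
apply: coord_drift_sum_le.
- by move=> z; have /andP[? _] := f01 z; rewrite mulr_ge0.
- exact: deterministic_cube.
- by move=> k; exact: neg_correlated_coord.
- move=> k; under eq_bigr do rewrite -[X in X * _]mulrA.
  under [X in X * _]eq_bigr do rewrite -mulrA.
  apply: (@neg_correlated_coord _ _ (fun x => f x * (1 - (x i)%:R))) => //.
    by move=> x; apply: mul_itv01 => //; exact: vacant01.
  by apply: cfg_decr_mul => //; [exact: vacant01|exact: vacant_decr].
Qed.

Lemma jump_op_spin_prod (u : 'I_n -> bool -> R) z :
  jump_op (spin_rate lam mu) (fun x => \prod_i u i (x i)) z =
  \sum_i flip_rate lam mu i z * ((u i (~~ z i) - u i (z i)) *
    \prod_(k | k != i) u k (z k)).
Proof.
rewrite jump_op_spin; apply: eq_bigr => i _; congr (_ * _).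
rewrite (bigD1 i)//= flip_same [X in _ - X](bigD1 i)//= mulrBl.
by congr (_ * _ - _); apply: eq_bigr => k ki; rewrite flip_other.
Qed.

(** [Phi r] runs the spin system on [[s, r]] and the independent chains on [[r, t]]. Its increments
    are nonnegative up to order [h ^+ 2] by [generator_comparison]. *)
Lemma site_product_le s t beta (v : 'I_n -> bool -> R) : 0 <= s <= t ->
  neg_correlated s beta ->
  (forall i b, 0 <= v i b <= 1) -> (forall i, v i true <= v i false) ->
  \sum_y beta y * \prod_i markov_op (pW i) s t (v i) (y i) <=
  \sum_y beta y * markov_op pX s t (fun z => \prod_i v i (z i)) y.
Proof.
move=> st bneg v01 vd; have /andP[s0 ts] := st; have t0 := le_trans s0 ts.
pose h_ r i := markov_op (pW i) r t (v i).
pose Phi r := \sum_y beta y * markov_op pX s r (fun z => \prod_i h_ r i (z i)) y.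
have Phis : Phi s = \sum_y beta y * \prod_i markov_op (pW i) s t (v i) (y i).
  by apply: eq_bigr => y _; rewrite (markov_op_id hpX).
have Phit : Phi t = \sum_y beta y * markov_op pX s t (fun z => \prod_i v i (z i)) y.
  apply: eq_bigr => y _; congr (_ * _); apply: eq_markov_op => z.
  by apply: eq_bigr => i _; rewrite /h_ (markov_op_id (hpW i)).
rewrite -Phis -Phit.
(* [prod_first_order] takes one constant for both the generator terms, bounded by [K], and the
   expansion errors, bounded by [CW]. *)
have KC0 : 0 <= K + CW by rewrite addr_ge0.
have [D D0 prodE] := prod_first_order n KC0.
have CD0 : 0 <= C + D by rewrite addr_ge0.
apply: (nondecreasing_of_quadratic_defect ts CD0) => r h sr h01 rht.
have /andP[h0 h1] := h01; have r0 := le_trans s0 sr.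
have rh0 : 0 <= r + h by rewrite addr_ge0.
have srI : 0 <= s <= r by rewrite s0.
have rrh : r <= r + h by rewrite lerDl.
have rrhI : 0 <= r <= r + h by rewrite r0.
have rhtI : 0 <= r + h <= t by rewrite rh0.
set u := h_ (r + h).
have u01 i b : 0 <= u i b <= 1 by apply: (markov_op_itv (hpW i)).
have ud i : u i true <= u i false.
  exact: (site_chain_decr (@site_rate_bd i) (hpW i) CW0 (@estW i)).
have normu i b : `|u i b| <= 1.
  by have /andP[? ?] := u01 i b; rewrite ger0_norm.
set gam := push s r (fun=> 1) beta.
have gneg : neg_correlated r gam.
  by apply: neg_correlated_push => // x; rewrite ler01 lexx.
have [g0 g1 _] := gneg.
have toGam g : \sum_y beta y * markov_op pX s r g y = \sum_z gam z * g z.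
  rewrite /gam sum_push; apply: eq_bigr => y _; congr (_ * _).
  by apply: eq_markov_op => z; rewrite mul1r.
rewrite /Phi toGam -/u.
under [leRHS]eq_bigr do rewrite (markov_op_comp hpX _ _ srI rrh).
rewrite toGam.
have pos := generator_comparison r0 gneg u01 ud.
set Q := fun z => \sum_i (flip_rate lam mu i z -
  site_rate lamx mux p i r (z i) (~~ z i)) * (u i (~~ z i) - u i (z i)) *
  \prod_(k | k != i) u k (z k).
have step z : \prod_i h_ r i (z i) + h * Q z - (C + D) * h ^+ 2 <=
    markov_op pX r (r + h) (fun x => \prod_i u i (x i)) z.
  have prod1 x : `|\prod_i u i (x i)| <= 1.
    by have /andP[? ?] := site_prod_itv predT x u01; rewrite ger0_norm.
  have := est z r0 h0 prod1; rewrite ler_norml => /andP[lowX _].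
  have cE i : `|h_ r i (z i) - (u i (z i) +
      h * jump_op (site_rate lamx mux p i r) (u i) (z i))| <= (K + CW) * h ^+ 2.
    rewrite /h_ (markov_op_comp (hpW i) _ _ rrhI rht).
    apply: le_trans (@estW i r h (u i) (z i) r0 h0 (normu i)) _.
    by rewrite ler_wpM2r ?sqr_ge0// lerDr.
  have bK i : `|jump_op (site_rate lamx mux p i r) (u i) (z i)| <= K + CW.
    apply: (@le_trans _ _ K); last by rewrite lerDl.
    exact: (jump_op_bool_bd (@site_rate_bd i)).
  have := prodE _ _ _ _ h01 (fun i => normu i (z i)) bK cE.
  rewrite ler_norml => /andP[_ upW].
  have QE : Q z = jump_op (spin_rate lam mu) (fun x => \prod_i u i (x i)) z -
      \sum_i jump_op (site_rate lamx mux p i r) (u i) (z i) *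
      \prod_(k | k != i) u k (z k).
    rewrite jump_op_spin_prod -sumrB; apply: eq_bigr => i _.
    by rewrite jump_op_bool; ring.
  by rewrite QE; lra.
apply: (@le_trans _ _ (\sum_z gam z * (\prod_i h_ r i (z i) + h * Q z -
    (C + D) * h ^+ 2))); last by apply: ler_sum => z _; rewrite ler_wpM2l.
have -> : \sum_z gam z * (\prod_i h_ r i (z i) + h * Q z - (C + D) * h ^+ 2) =
  \sum_z gam z * \prod_i h_ r i (z i) + h * \sum_z gam z * Q z -
  (\sum_z gam z) * ((C + D) * h ^+ 2).
  rewrite mulr_sumr mulr_suml -big_split -sumrB/=.
  by apply: eq_bigr => z _; ring.
have H1 : 0 <= h * \sum_z gam z * Q z by rewrite mulr_ge0.
have H2 : (\sum_z gam z) * ((C + D) * h ^+ 2) <= (C + D) * h ^+ 2.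
  by rewrite ler_piMl// mulr_ge0// sqr_ge0.
by lra.
Qed.

Definition vacant_config (a : R * {set 'I_n}) : R * pred (config n) :=
  (a.1, fun x => [forall i in a.2, ~~ x i]).

(** A site outside the set is observed without constraint, so that all sites share the same list of
    times. *)
Definition vacant_site i (a : R * {set 'I_n}) : R * pred bool :=
  (a.1, fun b => (i \in a.2) ==> ~~ b).

Lemma path_prob_site_decr i s L : 0 <= s ->
  path <=%R s (unzip1 (map (vacant_site i) L)) ->
  path_prob (pW i) s (map (vacant_site i) L) true <=
  path_prob (pW i) s (map (vacant_site i) L) false.
Proof.
elim: L s => [|[t B] L IHL] s s0 //= /andP[st tL].
have t0 := le_trans s0 st.
apply: (site_chain_decr (@site_rate_bd i) (hpW i) CW0 (@estW i)).
- by rewrite s0.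
- move=> b; have := path_prob_itv b (hpW i) t0 tL.
  by case: (_ ==> _); rewrite ?mul1r// mul0r lexx ler01.
- have := IHL t t0 tL; rewrite implybT mul1r.
  case: (_ ==> _); rewrite ?mul1r// mul0r => _.
  by have /andP[] := path_prob_itv false (hpW i) t0 tL.
Qed.

(** Up to the next observation [site_product_le] replaces the chains by the spin system. The
    indicator of the observation is decreasing and factorizes over sites, so [push] absorbs it into
    the weights. *)
Lemma path_prob_comparison s beta L : 0 <= s -> path <=%R s (unzip1 L) ->
  neg_correlated s beta ->
  \sum_y beta y * \prod_i path_prob (pW i) s (map (vacant_site i) L) (y i) <=
  \sum_y beta y * path_prob pX s (map vacant_config L) y.
Proof.
elim: L s beta => [|[t B] L IHL] s beta s0 /=.
  by move=> _ _; apply: ler_sum => y _; rewrite big1.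
move=> /andP[st tL] bneg; have t0 := le_trans s0 st.
have stI : 0 <= s <= t by rewrite s0.
have tLW i : path <=%R t (unzip1 (map (vacant_site i) L)).
  by rewrite /unzip1 -map_comp.
pose f (x : config n) : R := [forall i in B, ~~ x i]%:R.
have f01 x : 0 <= f x <= 1 by rewrite ler0n lern1 leq_b1.
have fd : cfg_decr f.
  move=> x y xy; rewrite /f ler_nat; case: forall_inP => // yB.
  by case: forall_inP => // -[] i iB; apply: contra (yB i iB); exact: xy.
have fE x : f x = \prod_i ((i \in B) ==> ~~ x i)%:R.
  rewrite /f; case: forall_inP => [xB|xB].
    by rewrite big1// => i _; case: (boolP (i \in B)) => // /xB ->.
  have [i iB xi] : exists2 i, i \in B & x i.
    apply: contrapT => h; apply: xB => i iB; apply/negP => xi.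
    by apply: h; exists i.
  by rewrite (bigD1 i)//= iB xi mul0r.
apply: le_trans (site_product_le stI bneg _ _) _.
- move=> i b; have := path_prob_itv b (hpW i) t0 (tLW i).
  by case: (_ ==> _); rewrite ?mul1r// mul0r lexx ler01.
- move=> i; have := path_prob_site_decr t0 (tLW i); rewrite implybT mul1r.
  case: (_ ==> _); rewrite ?mul1r// mul0r => _.
  by have /andP[] := path_prob_itv false (hpW i) t0 (tLW i).
have := IHL t (push s t f beta) t0 tL (neg_correlated_push stI f01 fd bneg).
rewrite !sum_push; apply: le_trans.
rewrite le_eqVlt; apply/orP; left; apply/eqP; apply: eq_bigr => y _.
congr (_ * _); apply: eq_markov_op => z.
by rewrite big_split/= fE.
Qed.

End Deterministic.
End Rates.

(** * Uniform constants, observation lists and the conclusion *)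

Lemma sum_pointmass (R : realType) (S : finType) (x0 : S) (g : S -> R) :
  \sum_x (x == x0)%:R * g x = g x0.
Proof.
rewrite (bigD1 x0)//= eqxx mul1r big1 ?addr0// => x xx0.
by rewrite (negbTE xx0) mul0r.
Qed.

Lemma generator_bool (R : realType) (q : R -> bool -> bool -> R) t a b :
  generator q t a b = (if a == b then -1 else 1) * q t a (~~ a).
Proof.
rewrite /generator; case: eqP => [_|/eqP ab]; last first.
  by rewrite mul1r; case: a b ab => [] [].
by rewrite mulN1r; congr (- _); rewrite big_mkcond big_bool; case: a;
  rewrite /= ?add0r ?addr0.
Qed.

Lemma process_sigma_algebra_future (R : realType) (d : measure_display)
    (T : measurableType d) (S : finType) (Y : R -> T -> S)
    (L : seq (R * pred S)) :
  (forall t, t \in unzip1 L -> 0 <= t) ->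
  process_sigma_algebra Y [set w | all (fun b => b.2 (Y b.1 w)) L].
Proof.
pose G := [set B | exists t y, 0 <= t /\ B = [set w | Y t w = y]].
(* Measurability of path events is applied on the sigma-algebra generated by [Y] itself. *)
move=> L0; apply: (@measurable_future R S _ (g_sigma_algebraType G) Y) => //.
move=> t y t0; apply: sub_sigma_algebra; by exists t, y.
Qed.

Lemma short_time_homogeneous (R : realType) (S : finType) (r : S -> S -> R)
    (p : R -> R -> S -> S -> R) :
  transition_function (fun=> r) p ->
  exists2 C, 0 <= C & short_time p (fun=> r) C.
Proof.
move=> hp; pose K : R := \sum_x \sum_y `|generator (fun=> r) 0 x y|.
have K0 : 0 <= K by apply: sumr_ge0 => x _; apply: sumr_ge0.
exists (#|S|%:R * (#|S|%:R * K ^+ 2 + K)).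
  by rewrite mulr_ge0// addr_ge0// mulr_ge0// sqr_ge0.
apply: short_time_estimate => // [t x y _|s t x y /andP[_ st]].
  rewrite /K (bigD1 x)//= (bigD1 y)//= -addrA lerDl addr_ge0// sumr_ge0// => z _.
  exact: sumr_ge0.
by rewrite /generator subrr normr0 mulr_ge0// subr_ge0.
Qed.

(** Points of the cube have norm at most 1, so a Lipschitz bound from the origin also bounds the
    values. *)
Lemma uniform_rate_bounds (R : realType) (n : nat)
    (f g : 'I_n -> 'rV[R]_n -> R) :
  (forall i, [lipschitz (f i x : R^o) | x in unit_cube n]) ->
  (forall i, [lipschitz (g i x : R^o) | x in unit_cube n]) ->
  exists2 K, 0 <= K & forall i,
    (forall x, unit_cube n x -> f i x <= K /\ g i x <= K) /\
    (forall x y, unit_cube n x -> unit_cube n y ->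
       `|f i x - f i y| <= K * `|x - y| /\ `|g i x - g i y| <= K * `|x - y|).
Proof.
move=> flip glip.
apply: (finite_uniform_bound (Q := fun i K =>
    (forall x, unit_cube n x -> f i x <= K /\ g i x <= K) /\
    (forall x y, unit_cube n x -> unit_cube n y ->
       `|f i x - f i y| <= K * `|x - y| /\ `|g i x - g i y| <= K * `|x - y|))).
  move=> i K K' KK' [bd lip]; split=> [x /bd[h1 h2]|x y cx cy].
    by split; exact: le_trans KK'.
  have [h1 h2] := lip x y cx cy.
  by split; [apply: le_trans h1 _|apply: le_trans h2 _]; rewrite ler_wpM2r.
move=> i; have [L fL] := lipschitz_on_cube (flip i).
have [L' gL] := lipschitz_on_cube (glip i).
have c0 : unit_cube n (0 : 'rV[R]_n) by move=> j; rewrite mxE lexx ler01.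
have norm1 x : unit_cube n x -> `|x - 0| <= 1.
  move=> cx; rewrite subr0; apply: rV_norm_le => // j.
  by have /andP[x0 x1] := cx j; rewrite ger0_norm.
have bd (h : 'rV[R]_n -> R) (M : R) : (forall x y, unit_cube n x ->
    unit_cube n y -> `|h x - h y| <= M * `|x - y|) ->
    forall x, unit_cube n x -> h x <= `|h 0| + `|M|.
  move=> hM x cx; rewrite -[h x](subrK (h 0)) addrC lerD ?ler_norm//.
  apply: le_trans (ler_norm _) _; apply: le_trans (hM x 0 cx c0) _.
  apply: (@le_trans _ _ (`|M| * `|x - 0|)).
    by rewrite ler_wpM2r// ler_norm.
  by rewrite ler_piMr// norm1.
exists (`|f i 0| + `|L| + (`|g i 0| + `|L'|)); split=> [x cx|x y cx cy].
  split.
    by apply: le_trans (bd _ _ fL x cx) _; rewrite lerDl addr_ge0.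
  by apply: le_trans (bd _ _ gL x cx) _; rewrite lerDr addr_ge0.
split.
  apply: le_trans (fL x y cx cy) _; rewrite ler_wpM2r//.
  by apply: le_trans (ler_norm L) _; rewrite addrAC lerDr !addr_ge0.
apply: le_trans (gL x y cx cy) _; rewrite ler_wpM2r//.
by apply: le_trans (ler_norm L') _; rewrite addrA lerDr !addr_ge0.
Qed.

Theorem theorem3p2 (R : realType) (n : nat) (hn : (0 < n)%N)
  (* the rates of the spin system, and their extensions to the unit cube
     (the values of the extensions outside of the cube are irrelevant) *)
  (lam mu : 'I_n -> config n -> R)
  (lamx mux : 'I_n -> 'rV[R]_n -> R)
  (hlam_ext : forall i x, lamx i (vec_of_config x) = lam i x)
  (hmu_ext : forall i x, mux i (vec_of_config x) = mu i x)
  (hlam_ge0 : forall i x, unit_cube n x -> 0 <= lamx i x)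
  (hmu_ge0 : forall i x, unit_cube n x -> 0 <= mux i x)
  (hlam_incr : forall i, increasing_on (unit_cube n) (lamx i))
  (hlam_conc : forall i, concave_on (unit_cube n) (lamx i))
  (hmu_decr : forall i, decreasing_on (unit_cube n) (mux i))
  (hmu_conv : forall i, convex_on (unit_cube n) (mux i))
  (hsum_incr : forall i,
     increasing_on (unit_cube n) (fun x => lamx i x + mux i x))
  (hsum_conc : forall i,
     concave_on (unit_cube n) (fun x => lamx i x + mux i x))
  (hlam_lip : forall i, [lipschitz (lamx i x : R^o) | x in unit_cube n])
  (hmu_lip : forall i, [lipschitz (mux i x : R^o) | x in unit_cube n])
  (x0 : config n)
  (d1 : measure_display) (T1 : measurableType d1) (P1 : probability T1 R)
  (X : R -> T1 -> config n)
  (hX : spin_system P1 lam mu x0 X)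
  (p : R -> 'rV[R]_n)
  (hp : deterministic_process lamx mux x0 p)
  (d2 : measure_display) (T2 : measurableType d2) (P2 : probability T2 R)
  (W : 'I_n -> R -> T2 -> bool)
  (hW : independent_site_approximation P2 lamx mux x0 p W)
  (A : {set 'I_n}) (m : 'I_n -> nat)
  (hm : forall i, i \in A -> (0 < m i)%N)
  (t : forall i : 'I_n, 'I_(m i) -> R)
  (ht : forall (i : 'I_n) (j : 'I_(m i)), i \in A -> 0 <= t i j) :
  (P2 [set w | forall (i : 'I_n) (j : 'I_(m i)),
                 i \in A -> W i (t i j) w = false]
   <= P1 [set w | forall (i : 'I_n) (j : 'I_(m i)),
                 i \in A -> X (t i j) w i = false])%E.
Proof.
have [K K0 Kbd] := uniform_rate_bounds hlam_lip hmu_lip.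
have lamx_bd i x : unit_cube n x -> 0 <= lamx i x <= K.
  by move=> cx; rewrite hlam_ge0//=; case: (Kbd i) => /(_ x cx)[].
have mux_bd i x : unit_cube n x -> 0 <= mux i x <= K.
  by move=> cx; rewrite hmu_ge0//=; case: (Kbd i) => /(_ x cx)[].
have lamx_lip i x y : unit_cube n x -> unit_cube n y ->
    `|lamx i x - lamx i y| <= K * `|x - y|.
  by move=> cx cy; case: (Kbd i) => _ /(_ x y cx cy)[].
have mux_lip i x y : unit_cube n x -> unit_cube n y ->
    `|mux i x - mux i y| <= K * `|x - y|.
  by move=> cx cy; case: (Kbd i) => _ /(_ x y cx cy)[].
have [mX _ P1X0 [pX hpX markovX]] := hX.
have [C C0 estX] := short_time_homogeneous hpX.
have [indW markovW] := hW.
have /choice[pW pWP] : forall i, exists q,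
    transition_function (site_rate lamx mux p i) q /\
    forall (l : seq (R * bool)) s t x y, 0 <= s <= t ->
      (forall a, a \in l -> 0 <= a.1 <= s) ->
      (P2 [set w | [/\ forall a, a \in l -> W i a.1 w = a.2,
                       W i s w = x & W i t w = y]] =
       P2 [set w | (forall a, a \in l -> W i a.1 w = a.2) /\ W i s w = x] *
       (q s t x y)%:E)%E.
  by move=> i; have [_ _ _ [q hq mq]] := markovW i; exists q.
have hpW i := (pWP i).1.
(* [K] bounds the site rates and [K ^+ 2] their Lipschitz constant in time along [p]; the sum serves
   for both. *)
pose K' := K + K ^+ 2.
have K'0 : 0 <= K' by rewrite addr_ge0// sqr_ge0.
pose CW : R := #|{: bool}|%:R * (#|{: bool}|%:R * K' ^+ 2 + K').
have CW0 : 0 <= CW by rewrite mulr_ge0// addr_ge0// mulr_ge0// sqr_ge0.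
have estW i : short_time (pW i) (site_rate lamx mux p i) CW.
  have norm_sign (a b : bool) (z : R) :
      `|(if a == b then -1 else 1) * z| = `|z|.
    by case: ifP; rewrite ?mulN1r ?normrN ?mul1r.
  apply: short_time_estimate => // [s a b s0|r s a b rs].
    rewrite generator_bool norm_sign.
    have /andP[q0 qK] := site_rate_bd K0 lamx_bd mux_bd hp i a (~~ a) s0.
    by rewrite ger0_norm// (le_trans qK)// lerDl sqr_ge0.
  rewrite !generator_bool -mulrBr norm_sign.
  have rs0 : 0 <= s - r by rewrite subr_ge0; case/andP: rs.
  apply: (@le_trans _ _ (K ^+ 2 * (s - r))).
    case: a => /=.
      exact: (mux_deterministic_lip K0 lamx_bd mux_bd mux_lip hp).
    exact: (lamx_deterministic_lip K0 lamx_bd mux_bd lamx_lip hp).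
  by rewrite ler_wpM2r// lerDr.
(* Each pair [(i, j)] with [i] in [A] gives an observation of the single site [i]; sorting by time
   merges them into one path. *)
pose obs := [seq (t (tag u) (tagged u), [set tag u]%SET) |
  u <- enum {: {i : 'I_n & 'I_(m i)}} & tag u \in A].
pose L := sort (fun a b : R * {set 'I_n} => a.1 <= b.1) obs.
have memL i j : i \in A -> (t i j, [set i]%SET) \in L.
  move=> iA; rewrite mem_sort; apply/mapP.
  by exists (Tagged (fun i => 'I_(m i)) j); rewrite // mem_filter iA mem_enum.
have Lmem a : a \in L -> exists i j, i \in A /\ a = (t i j, [set i]%SET).
  rewrite mem_sort => /mapP[u]; rewrite mem_filter => /andP[uA _] ->.
  by exists (tag u), (tagged u).
have L_ge0 s : s \in unzip1 L -> 0 <= s.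
  by move=> /mapP[a /Lmem[i [j [iA ->]]] ->]; exact: ht.
have L0 : path <=%R 0 (unzip1 L).
  rewrite path_min_sorted; last by apply/allP => s; exact: L_ge0.
  rewrite sorted_map; apply: sort_sorted => a b; exact: le_total.
have unzipX : unzip1 (map (@vacant_config R n) L) = unzip1 L.
  by rewrite /unzip1 -map_comp.
have unzipW i : unzip1 (map (vacant_site i) L) = unzip1 L.
  by rewrite /unzip1 -map_comp.
have P1E : P1 [set w | forall (i : 'I_n) (j : 'I_(m i)), i \in A ->
    X (t i j) w i = false] =
    (path_prob pX 0 (map (@vacant_config R n) L) x0)%:E.
  rewrite -(markov_path_from mX markovX P1X0) ?unzipX//; congr (P1 _).
  apply/seteqP; split=> w /= h; rewrite ?all_map.
    apply/allP => a /Lmem[i [j [iA ->]]] /=.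
    by apply/forall_inP => k; rewrite inE => /eqP->; rewrite h.
  move=> i j iA; move: h; rewrite all_map => /allP/(_ _ (memL i j iA)) /=.
  by move=> /forall_inP/(_ i (set11 i))/negbTE.
have P2E : P2 [set w | forall (i : 'I_n) (j : 'I_(m i)), i \in A ->
    W i (t i j) w = false] =
    (\prod_i path_prob (pW i) 0 (map (vacant_site i) L) (x0 i))%:E.
  (* Independence is used for all sites at once; a site outside [A] contributes the sure event. *)
  transitivity (P2 [set w | forall i, i \in [set: 'I_n]%SET ->
      [set w' | all (fun b => b.2 (W i b.1 w')) (map (vacant_site i) L)] w]).
    congr (P2 _); apply/seteqP; split=> w /= h => [i _|i j iA].
      rewrite all_map; apply/allP => a /Lmem[k [j [kA ->]]] /=.
      by apply/implyP; rewrite inE => /eqP ik; subst k; rewrite h.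
    have := h i (finset.in_setT i); rewrite all_map => /allP/(_ _ (memL i j iA)) /=.
    by rewrite set11 => /negbTE.
  rewrite indW => [|i _]; last first.
    by apply: process_sigma_algebra_future => s; rewrite unzipW; exact: L_ge0.
  rewrite -prodEFin; apply: eq_big => [i|i _]; first by rewrite finset.in_setT.
  have [mW _ P2W0 _] := markovW i.
  by rewrite (markov_path_from mW (pWP i).2 P2W0)// unzipW.
rewrite P1E P2E lee_fin.
(* Under the point mass at [x0] the correlation inequality is an equality. *)
have neg0 : neg_correlated x0 pX 0 (fun x => (x == x0)%:R).
  split=> [x||f w _ _ _ _]; first exact: ler0n.
    rewrite (eq_bigr (fun x => (x == x0)%:R * 1)) => [|x _]; last by rewrite mulr1.
    by rewrite sum_pointmass.
  by rewrite !sum_pointmass (markov_op_id hpX).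
have := path_prob_comparison hlam_ext hmu_ext K0 lamx_bd mux_bd lamx_lip
  mux_lip hlam_incr hmu_decr hmu_conv hsum_incr hsum_conc hp hpX C0 estX hpW
  CW0 estW (lexx 0) L0 neg0.
by rewrite !sum_pointmass.
Qed.
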